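(* Let $n\ge2$. (i) For almost every $\omega\in\mathbb R^n$ and for every $s>0$ there exist a function $f\in B^s_{\infty,\infty}(\mathbb T^n)$, a constant $C(\omega)>0$ and a sequence $T_j\to\infty$ such that for all $j$ $$\left|\frac1{T_j}\int_0^{T_j}f(\omega t)\,dt-\int_{\mathbb T^n}f(y)\,dy\right|\ge C(\omega)\cdot\frac1{T_j}.$$ (ii) If $n=2$ and $\omega\in\mathcal D(1,C_\omega,2)$, there exist $f\in B^1_{\infty,\infty}(\mathbb T^2)$, a constant $C>0$ and a sequence $T_j\to\infty$ such that for all $j$ $$\left|\frac1{T_j}\int_0^{T_j}f(\omega t)\,dt-\int_{\mathbb T^2}f(x)\,dx\right|\ge C\cdot\frac{\log(T_j)}{T_j}.$$ (iii) Let $\omega\in\mathcal D(\sigma,C_\omega,n)$ have exact Diophantine index $\sigma$, i.e. there are a constant $C'>0$ and a sequence $k_j\in\mathbb Z^n\setminus\{0\}$ with $|k_j|\to\infty$ such that $C_\omega|k_j|^{-\sigma}\le|k_j\cdot\omega|\le C'|k_j|^{-\sigma}$ for all $j$. Then for $0<s<\sigma$ there exist $f\in B^s_{\infty,\infty}(\mathbb T^n)$, a constant $C>0$ and a sequence $T_j\to\infty$ such that for all $j$ $$\left|\frac1{T_j}\int_0^{T_j}f(\omega t)\,dt-\int_{\mathbb T^n}f(x)\,dx\right|\ge C\cdot\left(\frac1{T_j}\right)^{s/\sigma}.$$ (iv) Let $\alpha\in(0,1)$. For almost every $\omega\in\mathbb R^n$ there exist $f\in B^\alpha_{\infty,\infty}(\mathbb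 T^n)$, a sequence $T_j\to\infty$, a constant $C_1(\omega)>0$ and, for every $\varepsilon>0$, a constant $C_2(\omega,\varepsilon)>0$ such that for all $\varepsilon>0$ and all $j$ $$C_1(\omega)\left(\frac1{T_j}\right)^{\alpha}\le\left|\frac1{T_j}\int_0^{T_j}f(\omega t)\,dt-\int_{\mathbb T^n}f(x)\,dx\right|\le C_2(\omega,\varepsilon)\left(\frac1{T_j}\right)^{\frac{\alpha}{n-1+\varepsilon}}.$$
   Context: $\mathbb T^n=\mathbb R^n/\mathbb Z^n$; functions on $\mathbb T^n$ are real valued and identified with $\mathbb Z^n$-periodic functions on $\mathbb R^n$; $|\cdot|$ is the Euclidean norm. Diophantine class: for $\sigma>0$, $C_\omega>0$, $\mathcal D(\sigma,C_\omega,n)$ is the set of $\omega\in\mathbb R^n$ with $|k\cdot\omega|\ge C_\omega|k|^{-\sigma}$ for all $k\in\mathbb Z^n\setminus\{0\}$. Besov spaces: let $\chi\in C_c^\infty(\mathbb R)$ be nonincreasing in $|s|$ with $\chi=1$ on $[-\frac34,\frac34]$ and $\operatorname{supp}\chi=[-\frac43,\frac43]$. For $s\ge0$ put $\varphi_{-1}(s)=\chi(s)$, $\varphi_0(s)=\chi(s/2)-\chi(s)$, $\varphi_j(s)=\varphi_0(2^{-j}s)$ for $j\ge1$, and $\varphi_j(\xi)=\varphi_j(|\xi|)$ for $\xi\in\mathbb R^n$. With $\widehat f(\xi)=\int_{\mathbb T^n}f(x)e^{-2\pi i\xi\cdot x}dx$, set $\Delta_jf(x)=\sum_{\xi\in\mathbb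 Z^n}\varphi_j(\xi)\widehat f(\xi)e^{2\pi i\xi\cdot x}$, $j\ge-1$. $B^s_{\infty,\infty}(\mathbb T^n)$ is the space of distributions $f$ with $\|f\|_{B^s_{\infty,\infty}}=\sup_{j\ge-1}2^{js}\|\Delta_jf\|_{L^\infty(\mathbb T^n)}<\infty$. *)

(* Defs.v *)
From HB Require Import structures.
From mathcomp Require Import all_boot all_order all_algebra.
From mathcomp Require Import all_classical all_reals all_analysis.
From mathcomp Require Import complex.

Set Implicit Arguments.
Unset Strict Implicit.
Unset Printing Implicit Defensive.

Import Order.TTheory GRing.Theory Num.Theory.
Import numFieldNormedType.Exports.

Local Open Scope classical_set_scope.
Local Open Scope ring_scope.

(* The library has product measures of two measures only.  The n-fold power of
   a sigma-finite measure lives on n.-tuple T, with the library's product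
   sigma-algebra, and is built by transporting mu \x mu^n along
   (x, t) |-> x :: t. *)

Section tuple_cons_measure.
Context d (T : measurableType d) (R : realType) (n : nat).
Variable mu : {sigma_finite_measure set T -> \bar R}.
Variable nu : {sigma_finite_measure set (n.-tuple T) -> \bar R}.

Definition pair_cons (p : T * n.-tuple T) : n.+1.-tuple T :=
  [tuple of p.1 :: p.2].

Lemma measurable_pair_cons : measurable_fun setT pair_cons.
Proof. by apply: measurable_cons => //; exact: measurable_snd. Qed.

Definition tuple_cons_measure : set (n.+1.-tuple T) -> \bar R :=
  pushforward (mu \x nu)%E pair_cons.

Let tcm0 : tuple_cons_measure set0 = 0%E.
Proof. by rewrite /tuple_cons_measure /pushforward preimage_set0 measure0. Qed.

Let tcm_ge0 A : (0 <= tuple_cons_measure A)%E.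
Proof. by rewrite /tuple_cons_measure /pushforward; exact: measure_ge0. Qed.

Let tcm_sigma_additive : semi_sigma_additive tuple_cons_measure.
Proof.
move=> F mF tF mUF; rewrite /tuple_cons_measure /pushforward preimage_bigcup.
apply: measure_semi_sigma_additive.
- by move=> k; rewrite -[X in measurable X]setTI; exact: measurable_pair_cons.
- apply/trivIsetP => /= i j _ _ ij; rewrite -preimage_setI.
  by move/trivIsetP : tF => /(_ _ _ _ _ ij) ->//; rewrite preimage_set0.
- rewrite -preimage_bigcup -[X in measurable X]setTI.
  exact: measurable_pair_cons.
Qed.

HB.instance Definition _ := isMeasure.Build _ _ _
  tuple_cons_measure tcm0 tcm_ge0 tcm_sigma_additive.

Let tcm_sigma_finite : sigma_finite setT tuple_cons_measure.
Proof.
have /sigma_finiteP[F [FT ndF Foo]] := sigma_finiteT mu.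
have /sigma_finiteP[G [GT ndG Goo]] := sigma_finiteT nu.
pose g (x : n.+1.-tuple T) := (thead x, [tuple of behead x]).
have mg : measurable_fun setT g.
  apply/measurable_fun_pair; [exact: measurable_tnth|exact: measurable_behead].
have gK p : g (pair_cons p) = p.
  case: p => x t; rewrite /g /pair_cons; congr pair => //.
  exact/val_inj.
exists (fun k => g @^-1` (F k `*` G k)).
  rewrite -preimage_bigcup (_ : \bigcup_k _ = setT) ?preimage_setT//.
  apply/seteqP; split=> // -[x t] _.
  have [k1 _ Fx] : (\bigcup_k F k) x by rewrite -FT.
  have [k2 _ Gt] : (\bigcup_k G k) t by rewrite -GT.
  exists (maxn k1 k2) => //; split => /=.
    by move: x Fx; exact/subsetPset/ndF/leq_maxl.
  by move: t Gt; exact/subsetPset/ndG/leq_maxr.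
move=> k; have [mF Fk] := Foo k; have [mG Gk] := Goo k.
have mFG : measurable (F k `*` G k) by exact: measurableX.
split; first by rewrite -[X in measurable X]setTI; exact: mg.
rewrite /tuple_cons_measure /pushforward -comp_preimage.
rewrite (_ : g \o pair_cons = id); last by apply/funext => p; exact: gK.
by rewrite preimage_id product_measure1E// lte_mul_pinfty// ge0_fin_numE.
Qed.

HB.instance Definition _ := Measure_isSigmaFinite.Build _ _ _
  tuple_cons_measure tcm_sigma_finite.

End tuple_cons_measure.

Fixpoint tuple_power d (T : measurableType d) (R : realType)
    (mu : {sigma_finite_measure set T -> \bar R}) (n : nat) :
    {sigma_finite_measure set (n.-tuple T) -> \bar R} :=
  match n with
  | 0 => \d_([tuple] : 0.-tuple T)
  | m.+1 => tuple_cons_measure mu (tuple_power mu m)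
  end.

Section torus.
Context (R : realType) (n : nat).
Implicit Types (f : 'rV[R]_n -> R) (x y w : 'rV[R]_n) (k : 'rV[int]_n).

Definition lebesgue_Rn : {sigma_finite_measure
    set (n.-tuple (measurableTypeR R)) -> \bar R} :=
  tuple_power lebesgue_measure n.

Lemma measurable_unit_itv :
  measurable (`[0%R, 1%R]%classic : set (measurableTypeR R)).
Proof. exact: measurable_itv. Qed.

Lemma lebesgue_unit_itv_fin :
  (lebesgue_measure (`[0%R, 1%R]%classic : set (measurableTypeR R)) < +oo)%E.
Proof. by rewrite lebesgue_measure_itv/= lte01 oppr0 adde0 ltry. Qed.

(* Lebesgue measure of the fundamental domain [0,1]^n: integrating a
   Z^n-periodic function against it is integrating over R^n / Z^n. *)
Definition torus_measure : {sigma_finite_measure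
    set (n.-tuple (measurableTypeR R)) -> \bar R} :=
  tuple_power (mfrestr measurable_unit_itv lebesgue_unit_itv_fin) n.

Definition row_of_tuple (t : n.-tuple (measurableTypeR R)) : 'rV[R]_n :=
  \row_i tnth t i.

Definition torus_int f : R :=
  \int[torus_measure]_t f (row_of_tuple t).

Definition dot x y : R := \sum_i x 0 i * y 0 i.

(* The library's norm on 'rV[R]_n is the sup norm. *)
Definition enorm x : R := Num.sqrt (\sum_i x 0 i ^+ 2).

Definition int_row k : 'rV[R]_n := map_mx intr k.

Definition diophantine (sigma C : R) : set 'rV[R]_n :=
  [set w | forall k, k != 0 ->
    C * enorm (int_row k) `^ (- sigma) <= `|dot (int_row k) w|].

Definition exact_index (sigma C : R) w : Prop :=
  exists (C' : R) (k : nat -> 'rV[int]_n),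
    [/\ 0 < C', forall j, k j != 0,
        enorm (int_row (k j)) @[j --> \oo] --> +oo &
        forall j,
          C * enorm (int_row (k j)) `^ (- sigma)
            <= `|dot (int_row (k j)) w|
            <= C' * enorm (int_row (k j)) `^ (- sigma)].

Definition is_cutoff (chi : R -> R) : Prop :=
  [/\ forall (m : nat) (s : R), derivable (derive1n m chi) s 1,
      forall s t : R, `|s| <= `|t| -> chi t <= chi s,
      forall s : R, - (3 / 4) <= s <= 3 / 4 -> chi s = 1 &
      closure [set s : R | chi s != 0] = `[- (4 / 3), 4 / 3]%classic].

(* Only j >= -1 matters: [Negz _] stands for j = -1. *)
Definition dyadic (chi : R -> R) (j : int) (s : R) : R :=
  match j with
  | Posz m => let r := (2 ^+ m)^-1 * s in chi (r / 2) - chi r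
  | Negz _ => chi s
  end.

Definition expi (theta : R) : R[i] := (cos theta +i* sin theta)%C.

Definition fourier f k : R[i] :=
  let g x := ((f x)%:C * expi (- (2 * pi * dot (int_row k) x)))%C in
  (torus_int (fun x => complex.Re (g x)) +i* torus_int (fun x => complex.Im (g x)))%C.

(* The support of chi being compact, only finitely many terms are nonzero. *)
Definition lp_block (chi : R -> R) f (j : int) x : R[i] :=
  \sum_(k \in [set: 'rV[int]_n])
    ((dyadic chi j (enorm (int_row k)))%:C * fourier f k *
      expi (2 * pi * dot (int_row k) x))%C.

Definition torus_Linfty (g : 'rV[R]_n -> R[i]) : \bar R :=
  Lnorm torus_measure +oo%E
    (fun t => (ComplexField.Normc.normc (g (row_of_tuple t)))%:E).

Definition besov_norm (chi : R -> R) (s : R) f : \bar R :=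
  ereal_sup [set ((2 `^ (j%:~R * s))%:E * torus_Linfty (lp_block chi f j))%E
            | j in [set j : int | -1 <= j]].

Definition periodic f : Prop := forall x k, f (x + int_row k) = f x.

(* The space B^s_{oo,oo}(T^n), to be used for s > 0 only.  Every distribution of
   finite norm is then a continuous function, and the continuous representative
   is the one that can be evaluated along the line t |-> t w. *)
Definition besov (chi : R -> R) (s : R) : set ('rV[R]_n -> R) :=
  [set f | [/\ continuous f, periodic f & (besov_norm chi s f < +oo)%E]].

Definition line_average f w (T : R) : R :=
  T^-1 * \int[lebesgue_measure]_(t in `[0, T]) f (t *: w).

Definition discrepancy f w (T : R) : R :=
  `|line_average f w T - torus_int f|.

(* Positivity only concerns finitely many terms; it excludes T_j = 0, at which
   the time average has no meaning. *)
Definition times_to_infty (T : nat -> R) : Prop :=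
  (forall j, 0 < T j) /\ T @ \oo --> +oo.

End torus.

(* Main.v *)
Require Import Defs.
From mathcomp Require Import all_boot all_order all_algebra.
From mathcomp Require Import all_classical all_reals all_analysis.
From mathcomp Require Import measurable_realfun ess_sup_inf complex ring lra.
Set Implicit Arguments.
Unset Strict Implicit.
Unset Printing Implicit Defensive.
Import Order.TTheory GRing.Theory Num.Theory.
Import numFieldNormedType.Exports.
Local Open Scope classical_set_scope.
Local Open Scope ring_scope.

(** All four lower bounds come from one family of functions, the lacunary sine
series

  f(x) = sum_i |k_i|^(-s) sin(2 pi k_i . x),    |k_(i+1)| >= 4 |k_i|,

with frequencies oriented so that theta_i = k_i . w > 0.

The factor 4 exceeds the ratio of the ends of a dyadic shell, so every
Littlewood-Paley block of f sees at most one pair of frequencies +-k_i, whose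
Fourier coefficients are bounded by |k_i|^(-s); hence f is in B^s
([sine_series_besov]).  Its mean is zero, and integrating term by term along the
line t w gives ([line_average_cvg])

  (1/T) int_0^T f(t w) dt
    = sum_i |k_i|^(-s) (1 - cos(2 pi theta_i T)) / (2 pi theta_i T).

The choice of sines makes every term nonnegative.  So the discrepancy is bounded
below by any single term, or any partial sum, and no estimate of the remaining
terms is needed for a lower bound.  What is left is to choose the frequencies.

- For the rate 1/T, take k_i = 4^i e for one non-resonant frequency e and let
  theta_0 T run through the half-integers.

- For an exact Diophantine index sigma, take a lacunary subsequence of the given
  k_j and T_j = 1 / (2 theta_j): the j-th term alone is (2/pi) |k_j|^(-s), and
  theta_j <= C' |k_j|^(-sigma) turns this into T_j^(-s/sigma).

- For the logarithm, Dirichlet's pigeonhole argument at Q = A^i together with the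
  Diophantine condition gives |k_i| and 1 / theta_i both comparable to A^i.  All
  quotients |k_i|^(-1) / theta_i are then bounded below, and T times the
  discrepancy is at least a constant times sum_(i <= N) (1 - cos(2 pi theta_i T)).
  The mean value theorem, applied to the primitive of this sum on [X, 2X], yields
  a T at which the sum is at least (N + 1) / 2 ([resonant_time]), while log T is
  at most of order N.

- For the two-sided bound, Dirichlet frequencies are multiplied by integers until
  theta_i |k_i| lies between two constants ([balanced_frequency]).  At
  T_j = 1 / (2 theta_j) the terms before and after the j-th are dominated by
  geometric sums, so that the discrepancy is comparable to T_j^(-alpha).  Since
  n - 1 + eps >= 1 and T_j >= 1, this is stronger than the required upper bound.
  The construction applies when the first two coordinates of w are rationally
  independent, that is, off a countable union of null hyperplanes
  ([ae_independent]). *)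

(** * Trigonometric integrals over the torus *)

Lemma integral_is_derive (R : realType) (F f : R -> R) (a b : R) : a < b ->
  (forall x : R, is_derive x 1 F (f x)) -> continuous f ->
  (\int[lebesgue_measure]_(x in `[a, b]) (f x)%:E = (F b - F a)%:E)%E.
Proof.
move=> ab dF cf.
have cF : continuous F.
  by move=> x; apply/differentiable_continuous/derivable1_diffP; have [] := dF x.
rewrite (@continuous_FTC2 _ f F)//.
- exact: continuous_subspaceT.
- split; first by move=> x _; have [] := dF x.
  + by apply: cvg_at_right_filter; exact: cF.
  + by apply: cvg_at_left_filter; exact: cF.
- by move=> x _; rewrite derive1E; have [_ ->] := dF x.
Qed.

Lemma is_derive_sin_affine (R : realType) (b c x : R) :
  is_derive x 1 (fun y => sin (b * y + c)) (b * cos (b * x + c)).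
Proof.
have h : is_derive x 1 (fun y : R => b * y + c) b.
  by apply: is_derive_eq; rewrite addr0 scaler1.
rewrite mulrC; exact: (@is_derive1_comp _ sin _ _ _ _ (is_derive_sin _) h).
Qed.

Lemma is_derive_cos_affine (R : realType) (b c x : R) :
  is_derive x 1 (fun y => cos (b * y + c)) (- (b * sin (b * x + c))).
Proof.
have h : is_derive x 1 (fun y : R => b * y + c) b.
  by apply: is_derive_eq; rewrite addr0 scaler1.
rewrite mulrC -mulNr.
exact: (@is_derive1_comp _ cos _ _ _ _ (is_derive_cos _) h).
Qed.

Lemma integral_sin (R : realType) (b T : R) : b != 0 -> 0 < T ->
  \int[lebesgue_measure]_(t in `[0, T]) sin (b * t) = (1 - cos (b * T)) / b.
Proof.
move=> b0 T0.
have dF (x : R) : is_derive x 1 (fun x => - b^-1 * cos (b * x + 0)) (sin (b * x)).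
  have h := is_derive_cos_affine b 0 x.
  by apply: is_derive_eq; rewrite /GRing.scale /= addr0 mulrNN mulKf.
rewrite /Rintegral (integral_is_derive T0 dF) /=.
  by rewrite mulr0 !addr0 cos0; ring.
have cs : continuous (sin \o ( *%R b : R -> R)).
  move=> x; apply: continuous_comp; last exact: continuous_sin.
  exact: mulrl_continuous.
exact: cs.
Qed.

Lemma row_of_tupleE (R : realType) n (t : n.-tuple (measurableTypeR R)) i :
  row_of_tuple t 0 i = tnth t i.
Proof. by rewrite mxE. Qed.

Lemma torus_measureT (R : realType) n : torus_measure R n setT = 1%E.
Proof.
elim: n => [|n ih]; first by rewrite /torus_measure /= diracE in_setT.
rewrite /torus_measure /= /tuple_cons_measure /pushforward preimage_setT -setXTT.
rewrite product_measure1E// -/(torus_measure R n) ih mule1.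
by rewrite /= /mfrestr /mrestr setTI lebesgue_measure_itv/= lte01 oppr0 adde0.
Qed.

(** The complement of [D] is null for the restricted measure, and inside [D] the
two measures agree. *)
Lemma integral_mfrestr (R : realType) d (T : measurableType d)
    (mu : {measure set T -> \bar R}) (D : set T) (mD : measurable D)
    (Doo : (mu D < +oo)%E) (f : T -> \bar R) :
  (mfrestr mD Doo).-integrable setT f ->
  (\int[mfrestr mD Doo]_x f x = \int[mu]_(x in D) f x)%E.
Proof.
move=> fi; rewrite (@negligible_integral _ _ _ (mfrestr mD Doo) setT (~` D))//.
- rewrite setTD setCK; apply: eq_measure_integral => A mA AD.
  by rewrite /= /mfrestr /mrestr setIidl.
- exact: measurableC.
- by rewrite /= /mfrestr /mrestr setICl measure0.
Qed.

Lemma bounded_integrable (R : realType) d (T : measurableType d)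
    (mu : {measure set T -> \bar R}) (D : set T) (M : R) (f : T -> R) :
  measurable D -> (mu D < +oo)%E -> measurable_fun D f ->
  (forall x, `|f x| <= M) -> mu.-integrable D (EFin \o f).
Proof.
move=> mD Doo mf fM; apply: measurable_bounded_integrable => //.
by exists M; split; rewrite ?num_real// => N MN x _ /=; exact: le_trans (fM x) (ltW MN).
Qed.

(** The recursion behind all torus integrals: the measure on [n.+1]-tuples is the
image of a product, so Fubini splits off the first coordinate. *)
Lemma torus_integral_cons (R : realType) n (M : R)
    (g : n.+1.-tuple (measurableTypeR R) -> R) :
  measurable_fun setT g -> (forall t, `|g t| <= M) ->
  (\int[torus_measure R n.+1]_t (g t)%:E =
   \int[lebesgue_measure]_(x in `[0%R, 1%R])
     \int[torus_measure R n]_t (g [tuple of x :: t])%:E)%E.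
Proof.
move=> mg gM.
have mgc : measurable_fun setT (g \o @pair_cons _ (measurableTypeR R) n).
  by apply: measurableT_comp => //; exact: measurable_pair_cons.
pose m0 := mfrestr (@measurable_unit_itv R) (@lebesgue_unit_itv_fin R).
have gi : ((m0 \x torus_measure R n)%E).-integrable setT
    (EFin \o (g \o @pair_cons _ (measurableTypeR R) n)).
  apply: (@bounded_integrable _ _ _ _ _ M) => //; last by move=> p; exact: gM.
  have := torus_measureT R n.+1.
  rewrite /torus_measure /= /tuple_cons_measure /pushforward preimage_setT => ->.
  exact: ltry.
transitivity (\int[(m0 \x torus_measure R n)%E]_p (g (pair_cons p))%:E)%E.
  rewrite -[RHS](@integral_pushforward _ _ _ _ _
    (@pair_cons _ (measurableTypeR R) n) _ _ setT (EFin \o g))//.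
  - exact: measurable_pair_cons.
  - exact/measurable_EFinP.
rewrite -(integral12_prod_meas1 gi).
exact: (integral_mfrestr (integrable_fubini_F gi)).
Qed.

Lemma measurable_affine_tuple (R : realType) n (m : 'I_n -> int) (c : R) :
  measurable_fun setT (fun t : n.-tuple (measurableTypeR R) =>
    2 * pi * (\sum_i (m i)%:~R * tnth t i) + c).
Proof.
apply: measurable_funD => //; apply: measurable_funM => //.
by apply: measurable_sum => i; apply: measurable_funM => //; exact: measurable_tnth.
Qed.

Lemma sin_periodZ (R : realType) (m : int) (c : R) :
  sin (c + 2 * pi * m%:~R) = sin c.
Proof.
have peri (k : nat) (x : R) : sin (x + 2 * pi * k%:R) = sin x.
  elim: k x => [|k ih] x; first by rewrite mulr0 addr0.
  rewrite -[k.+1]addn1 natrD mulrDr mulr1 addrA.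
  by rewrite mulr_natl sinD2pi -mulr_natl ih.
case: (intP m) => [|k|k]; first by rewrite mulr0 addr0.
  by rewrite -pmulrn peri.
by rewrite mulrNz -pmulrn mulrN -(peri k.+1) subrK.
Qed.

Lemma cos_integral_unit (R : realType) (m : int) (c : R) : m != 0 ->
  (\int[lebesgue_measure]_(x in `[0%R, 1%R]) (cos (2 * pi * m%:~R * x + c))%:E
     = 0)%E.
Proof.
move=> m0; set b := 2 * pi * m%:~R.
have b0 : b != 0 by rewrite !mulf_neq0 ?intr_eq0// ?pnatr_eq0// gt_eqF ?pi_gt0.
have dF (x : R) : is_derive x 1 (fun x => b^-1 * sin (b * x + c)) (cos (b * x + c)).
  have h := is_derive_sin_affine b c x.
  by apply: is_derive_eq; rewrite /GRing.scale /= mulKf.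
rewrite (integral_is_derive ltr01 dF).
  by rewrite mulr1 mulr0 add0r [b + c]addrC sin_periodZ subrr.
move=> x; apply: (@continuous_comp _ _ _ (fun y => b * y + c) cos).
  by apply: cvgD; [apply: cvgMr|exact: cvg_cst].
exact: continuous_cos.
Qed.

(** The phase [c] is what makes the induction on the dimension work: once the first
coordinate is split off, it becomes part of the phase of the remaining
integral.  It also covers sines. *)
Lemma torus_integral_cos (R : realType) n (m : 'I_n -> int) (c : R) :
  (exists i, m i != 0) ->
  (\int[torus_measure R n]_t
    (cos (2 * pi * (\sum_i (m i)%:~R * tnth t i) + c))%:E = 0)%E.
Proof.
elim: n m c => [|n ih] m c [i mi]; first by case: i mi.
rewrite (@torus_integral_cons _ _ 1); last 2 first.
- apply: measurableT_comp; last exact: measurable_affine_tuple.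
  exact: (continuous_measurable_fun (@continuous_cos R)).
- by move=> t; rewrite cos_max.
have inner x : (\int[torus_measure R n]_t
    (cos (2 * pi * (\sum_i (m i)%:~R * tnth [tuple of x :: t] i) + c))%:E =
  \int[torus_measure R n]_t (cos (2 * pi *
    (\sum_i (m (lift ord0 i))%:~R * tnth t i) +
       (2 * pi * (m ord0)%:~R * x + c)))%:E)%E.
  apply: eq_integral => t _; rewrite big_ord_recl tnth0.
  under eq_bigr do rewrite tnthS.
  by congr (cos _)%:E; ring.
under eq_integral do rewrite inner.
have [[j mj]|m0] := pselect (exists j, m (lift ord0 j) != 0).
  by rewrite integral0_eq// => x _; apply: ih; exists j.
have m0' j : m (lift ord0 j) = 0.
  by apply: contrapT => /eqP mj; apply: m0; exists j.
have {}inner x : (\int[torus_measure R n]_t (cos (2 * pi *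
    (\sum_i (m (lift ord0 i))%:~R * tnth t i) +
       (2 * pi * (m ord0)%:~R * x + c)))%:E =
   (cos (2 * pi * (m ord0)%:~R * x + c))%:E)%E.
  under eq_integral => t _.
    under eq_bigr do rewrite m0' mul0r.
    rewrite big1_eq mulr0 add0r. over.
  by rewrite integral_cst// [X in (_ * X)%E](torus_measureT R n) mule1.
under eq_integral do rewrite inner.
apply: cos_integral_unit.
by case: (unliftP ord0 i) mi => [j ->|->]//; rewrite m0' eqxx.
Qed.

(** * Uniformly convergent series *)

(** A series of functions dominated by a convergent numerical series is handled
through its explicit tail, which gives continuity and termwise integration on
sets of finite measure. *)
Section weierstrass.
Context (R : realType) (T : Type) (u : nat -> T -> R) (a : nat -> R).
Hypothesis ua : forall i x, `|u i x| <= a i.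
Hypothesis ca : cvgn (series a).

Lemma weierstrass_cvg x : cvgn (series (u^~ x)).
Proof.
apply: normed_cvg; apply: series_le_cvg ca => //= i.
by apply: le_trans (ua i x).
Qed.

Lemma weierstrass_tail N x :
  `|limn (series (u^~ x)) - series (u^~ x) N| <= limn (series a) - series a N.
Proof.
have cu := @weierstrass_cvg x.
apply: (@ler_cvg_to _ \oo _ _ (fun n => `|series (u^~ x) n - series (u^~ x) N|)
    (fun n => series a n - series a N)).
- by apply: cvg_norm; apply: cvgB => //; exact: cvg_cst.
- by apply: cvgB => //; exact: cvg_cst.
near=> n.
have Nn : (N <= n)%N by near: n; exact: nbhs_infty_ge.
rewrite /= !sub_series_geq//; apply: le_trans (ler_norm_sum _ _ _) _.
by apply: ler_sum => i _.
Unshelve. all: by end_near. Qed.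
End weierstrass.

Lemma weierstrass_continuous (R : realType) (T : topologicalType)
    (u : nat -> T -> R) (a : nat -> R) :
  (forall i x, `|u i x| <= a i) -> cvgn (series a) ->
  (forall i, continuous (u i)) -> continuous (fun x => limn (series (u^~ x))).
Proof.
move=> ua ca cu x; apply/cvgrPdist_lt => e e0.
have e3 : 0 < e / 3 by rewrite divr_gt0.
have [N tailN] : exists N, limn (series a) - series a N < e / 3.
  have /cvgrPdist_lt/(_ _ e3)[N _ hN] := ca.
  by exists N; apply: le_lt_trans (hN N (leqnn N)); exact: ler_norm.
have cS : {for x, continuous (fun y => series (u^~ y) N)}.
  have -> : (fun y => series (u^~ y) N) = \sum_(0 <= i < N) u i.
    by apply/funext => y; rewrite /series /= fct_sumE.
  elim/big_ind : _ => [|f g hf hg|i _].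
  - exact: cst_continuous.
  - exact: cvgD.
  - exact: cu.
have /cvgrPdist_lt/(_ _ e3) := cS.
apply: filterS => y hy.
have h1 := le_lt_trans (weierstrass_tail ua ca N x) tailN.
have h2 := le_lt_trans (weierstrass_tail ua ca N y) tailN.
move: hy h1 h2; rewrite !ltr_norml => /andP[? ?] /andP[? ?] /andP[? ?].
by apply/andP; split; lra.
Qed.

Lemma Rintegral_sum (R : realType) d (T : measurableType d)
    (mu : {measure set T -> \bar R}) (D : set T) (u : nat -> T -> R) N :
  measurable D -> (forall i, mu.-integrable D (EFin \o u i)) ->
  \int[mu]_(x in D) (\sum_(0 <= i < N) u i x) =
  \sum_(0 <= i < N) \int[mu]_(x in D) u i x.
Proof.
move=> mD iu; have iS n : mu.-integrable D (EFin \o (fun x => \sum_(0 <= i < n) u i x)).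
  elim: n => [|n ihn].
    by apply: eq_integrable (integrable0 mu D) => // x _ /=; rewrite big_geq.
  apply: eq_integrable (integrableD mD ihn (iu n)) => // x _ /=.
  by rewrite big_nat_recr.
elim: N => [|N ih].
  by under eq_Rintegral do rewrite big_geq//; rewrite Rintegral_cst// mul0r big_geq.
under eq_Rintegral do rewrite big_nat_recr//=.
by rewrite RintegralD// ih big_nat_recr.
Qed.

Lemma weierstrass_integral (R : realType) d (T : measurableType d)
    (mu : {measure set T -> \bar R}) (D : set T) (u : nat -> T -> R)
    (a : nat -> R) :
  measurable D -> (mu D < +oo)%E -> (forall i, measurable_fun setT (u i)) ->
  (forall i x, `|u i x| <= a i) -> cvgn (series a) ->
  series (fun i => \int[mu]_(x in D) u i x) @ \oo -->
    \int[mu]_(x in D) limn (series (u^~ x)).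
Proof.
move=> mD Doo mu_ ua ca.
have iu i : mu.-integrable D (EFin \o u i).
  by apply: (@bounded_integrable _ _ _ _ _ (a i)) => //; exact: measurable_funTS.
have mS N : measurable_fun setT (fun x => series (u^~ x) N).
  by rewrite /series /=; exact: measurable_sum.
have mF : measurable_fun setT (fun x => limn (series (u^~ x))).
  apply: (@measurable_fun_cvg _ _ _ _ (fun N x => series (u^~ x) N)) => //.
  by move=> x _; apply: weierstrass_cvg ua ca _.
have a0 i (x0 : T) : 0 <= a i := le_trans (normr_ge0 _) (ua i x0).
have [|||||iF _ cI] := @dominated_convergence _ _ _ mu D mD
  (fun N x => (series (u^~ x) N)%:E) (fun x => (limn (series (u^~ x)))%:E)
  (cst (limn (series a))%:E).
- by move=> N; apply/measurable_EFinP; exact: measurable_funTS.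
- by apply/measurable_EFinP; exact: measurable_funTS.
- apply/aeW => x _; apply/cvg_EFin; first exact: nearW.
  exact: weierstrass_cvg ua ca x.
- apply: (@bounded_integrable _ _ _ _ _ `|limn (series a)|) => //.
- apply/aeW => x N _; rewrite lee_fin; apply: le_trans (ler_norm_sum _ _ _) _.
  apply: (@le_trans _ _ (series a N)); first by apply: ler_sum.
  apply: nondecreasing_cvgn_le => //; apply: nondecreasing_series => i _ _.
  exact: a0 i x.
have -> : series (fun i => \int[mu]_(x in D) u i x) =
    (fun N => fine (\int[mu]_(x in D) (series (u^~ x) N)%:E)%E).
  by apply/funext => N; rewrite [LHS]/series /= -Rintegral_sum.
apply: fine_cvg; rewrite fineK//; exact: integrable_fin_num iF.
Qed.

(** * Frequencies and torus integrals of plane waves *)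

Section frequencies.
Context (R : realType) (n : nat).
Implicit Types (k l : 'rV[int]_n) (x y w : 'rV[R]_n).

Lemma enormN k : enorm (int_row R (- k)) = enorm (int_row R k).
Proof.
by congr Num.sqrt; apply: eq_bigr => i _; rewrite !mxE mulrNz sqrrN.
Qed.

Lemma enormZ (c : R) x : 0 <= c -> enorm (c *: x) = c * enorm x.
Proof.
move=> c0; rewrite /enorm; under eq_bigr do rewrite mxE exprMn.
by rewrite -mulr_sumr sqrtrM ?sqr_ge0// sqrtr_sqr ger0_norm.
Qed.

Lemma enorm_ge1 k : k != 0 -> 1 <= enorm (int_row R k).
Proof.
move=> k0; have [i ki] : exists i, k 0 i != 0.
  apply/existsP; apply: contraNT k0 => /existsPn h; apply/eqP/rowP => i.
  by rewrite mxE; apply/eqP; move: (h i); rewrite negbK.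
rewrite -[leLHS]sqrtr1 ler_wsqrtr// (bigD1 i)//=.
apply: ler_wpDr; first by apply: sumr_ge0 => j _; exact: sqr_ge0.
rewrite mxE -real_normK ?num_real// -[leLHS](expr1n _ 2) lerXn2r ?nnegrE//.
by rewrite -intr_norm (ler_int _ 1) -gtz0_ge1 normr_gt0.
Qed.

Lemma enorm_ge0 x : 0 <= enorm x. Proof. exact: sqrtr_ge0. Qed.

Lemma dotZl (c : R) x w : dot (c *: x) w = c * dot x w.
Proof. by rewrite /dot mulr_sumr; apply: eq_bigr => i _; rewrite mxE mulrA. Qed.

Lemma dotDl x y w : dot (x + y) w = dot x w + dot y w.
Proof. by rewrite /dot -big_split; apply: eq_bigr => i _; rewrite mxE mulrDl. Qed.

Lemma dotNl x w : dot (- x) w = - dot x w.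
Proof. by rewrite /dot -sumrN; apply: eq_bigr => i _; rewrite mxE mulNr. Qed.

Lemma dotDr x y w : dot w (x + y) = dot w x + dot w y.
Proof. by rewrite /dot -big_split; apply: eq_bigr => i _; rewrite mxE mulrDr. Qed.

Lemma dotZr (t : R) x w : dot w (t *: x) = t * dot w x.
Proof. by rewrite /dot mulr_sumr; apply: eq_bigr => i _; rewrite mxE mulrCA. Qed.

Lemma int_rowD k l : int_row R (k + l) = int_row R k + int_row R l.
Proof. exact: map_mxD. Qed.

Lemma int_rowN k : int_row R (- k) = - int_row R k.
Proof. exact: map_mxN. Qed.

Lemma int_rowMn k (m : nat) : int_row R (k *+ m) = m%:R *: int_row R k.
Proof.
rewrite scaler_nat; elim: m => [|m ih]; first by rewrite !mulr0n /int_row map_mx0.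
by rewrite !mulrS int_rowD ih.
Qed.

Lemma dot_int k l : exists m : int, dot (int_row R k) (int_row R l) = m%:~R.
Proof.
exists (\sum_i k 0 i * l 0 i); rewrite /dot rmorph_sum; apply: eq_bigr => i _.
by rewrite !mxE rmorphM.
Qed.

Lemma continuous_dot w : continuous (dot w).
Proof.
apply: continuous_big => [|i _ x]; first exact: add_continuous.
exact: (cvgM (cvg_cst _) (@coord_continuous R 1 n 0 i x)).
Qed.

Lemma torus_int_cos k (c : R) : k != 0 ->
  torus_int (fun x => cos (2 * pi * dot (int_row R k) x + c)) = 0.
Proof.
move=> k0; rewrite /torus_int /Rintegral.
under eq_integral => t _.
  rewrite /dot; under eq_bigr do rewrite row_of_tupleE mxE.
over.
rewrite torus_integral_cos//.
apply/existsP; apply: contraNT k0 => /existsPn h; apply/eqP/rowP => i.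
by rewrite mxE; apply/eqP; move: (h i); rewrite negbK.
Qed.

End frequencies.

(** Orthogonality leaves a single nonzero term in the series for a Fourier
coefficient; this identifies the coefficient with that term. *)
Lemma cvg_series_single (R : realType) (t : nat -> R) (i : nat) (l : R) :
  (forall j, j != i -> t j = 0) -> series t @ \oo --> l -> l = t i.
Proof.
move=> t0 tl; apply/esym.
have ti : series t @ \oo --> t i.
  apply: cvg_near_cst; near=> N.
  have iN : (i < N)%N by near: N; exact: nbhs_infty_gt.
  rewrite /series /= big_mkord (bigD1 (Ordinal iN))//= big1 ?addr0// => j ji.
  by apply: t0; apply: contra ji => /eqP ji; apply/eqP/val_inj.
exact: (cvg_unique _ ti tl).
Unshelve. all: by end_near. Qed.

Section torus_functions.
Context (R : realType) (n : nat).
Implicit Types (k l : 'rV[int]_n) (x y w : 'rV[R]_n).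

Lemma measurable_wave k (c : R) (g : R -> R) : continuous g ->
  measurable_fun setT (fun t : n.-tuple (measurableTypeR R) =>
    g (2 * pi * dot (int_row R k) (row_of_tuple t) + c)).
Proof.
move=> cg; rewrite /dot.
rewrite (_ : (fun t => _) = g \o (fun t : n.-tuple (measurableTypeR R) =>
    2 * pi * (\sum_i (k 0 i)%:~R * tnth t i) + c)).
  apply: measurableT_comp; first exact: continuous_measurable_fun.
  exact: measurable_affine_tuple.
apply/funext => t /=; congr (g (_ * _ + _)).
by apply: eq_bigr => i _; rewrite row_of_tupleE mxE.
Qed.

Lemma torus_integrable (M : R) (g : n.-tuple (measurableTypeR R) -> R) :
  measurable_fun setT g -> (forall t, `|g t| <= M) ->
  (torus_measure R n).-integrable setT (EFin \o g).
Proof.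
move=> mg gM; apply: (@bounded_integrable _ _ _ _ _ M) => //.
by rewrite [X in (X < _)%E](torus_measureT R n) ltry.
Qed.

Lemma torus_int_le (M : R) (g : 'rV[R]_n -> R) :
  measurable_fun setT (fun t : n.-tuple (measurableTypeR R) =>
    g (row_of_tuple t)) ->
  (forall x, `|g x| <= M) -> `|torus_int g| <= M.
Proof.
move=> mg gM; have ig := torus_integrable mg (fun t => gM _).
rewrite /torus_int; apply: le_trans (le_normr_Rintegral _ ig) _ => //.
have -> : M = \int[torus_measure R n]_t M.
  by rewrite Rintegral_cst// [X in fine X](torus_measureT R n) mulr1.
apply: le_Rintegral => //; first exact: integrable_abse ig.
apply: (@torus_integrable `|M|); first exact: measurable_cst.
by move=> _.
Qed.

Lemma sin_mul_cos (a b : R) :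
  sin a * cos b = 2^-1 * (cos (a + b - pi / 2) + cos (a - b - pi / 2)).
Proof. by rewrite !cosBpihalf sinD sinB; field. Qed.

(** The product is half the sum of two waves with frequencies [k + l] and [k - l],
both nonzero, so each integrates to zero. *)
Lemma torus_int_sin_cos k l (c : R) : l != k -> l != - k ->
  torus_int (fun x => sin (2 * pi * dot (int_row R k) x) *
                      cos (2 * pi * dot (int_row R l) x + c)) = 0.
Proof.
move=> lk lNk.
have kl : k + l != 0 by rewrite addrC addr_eq0.
have kl' : k - l != 0 by rewrite subr_eq0 eq_sym.
rewrite (_ : (fun x => _) = (fun x =>
   2^-1 * (cos (2 * pi * dot (int_row R (k + l)) x + (c - pi / 2)) +
           cos (2 * pi * dot (int_row R (k - l)) x + (- c - pi / 2))))).
  have iw k' c' := torus_integrable (measurable_wave k' c' (@continuous_cos R))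
    (fun t => cos_max _).
  rewrite /torus_int RintegralZl//; last exact: integrableD (iw _ _) (iw _ _).
  rewrite RintegralD; [|exact: measurableT|exact: iw|exact: iw].
  rewrite ![X in _ * (X + _)]torus_int_cos// [X in _ * (_ + X)]torus_int_cos//.
  by rewrite addr0 mulr0.
apply/funext => x; rewrite sin_mul_cos !int_rowD int_rowN !dotDl dotNl.
by congr (_ * (cos _ + cos _)); ring.
Qed.

End torus_functions.

(** * Complex modulus, powers and dyadic cutoffs *)

Lemma powR_homo (R : realType) (s x y : R) : 0 <= s -> 0 <= x -> x <= y ->
  x `^ s <= y `^ s.
Proof.
by move=> s0 x0 xy; rewrite ge0_ler_powR// nnegrE// (le_trans x0).
Qed.

Lemma powR_anti (R : realType) (s x y : R) : 0 <= s -> 0 < x -> x <= y ->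
  y `^ (- s) <= x `^ (- s).
Proof.
move=> s0 x0 xy; have y0 := lt_le_trans x0 xy.
by rewrite !powRN lef_pV2 ?posrE ?powR_gt0// powR_homo// ltW.
Qed.

Lemma normc_le (R : realType) (x y : R) :
  ComplexField.Normc.normc (x +i* y)%C <= `|x| + `|y|.
Proof.
rewrite /ComplexField.Normc.normc -[leRHS]ger0_norm ?addr_ge0// -sqrtr_sqr.
rewrite ler_wsqrtr// sqrrD !real_normK ?num_real// addrAC lerDl.
by rewrite mulrn_wge0// mulr_ge0.
Qed.

Lemma normc_expi (R : realType) (theta : R) : ComplexField.Normc.normc (expi theta) = 1.
Proof. by rewrite /ComplexField.Normc.normc /expi cos2Dsin2 sqrtr1. Qed.

Lemma normc_real (R : realType) (x : R) : ComplexField.Normc.normc x%:C%C = `|x|.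
Proof. by rewrite /ComplexField.Normc.normc /= expr0n addr0 sqrtr_sqr. Qed.

Section cutoff.
Context (R : realType) (chi : R -> R).
Hypothesis chi_cutoff : is_cutoff chi.

Lemma cutoff_eq0 (x : R) : 4 / 3 < `|x| -> chi x = 0.
Proof.
move=> x43; apply: contrapT => /eqP cx; have [_ _ _ cl] := chi_cutoff.
have : closure [set y | chi y != 0] x by exact: subset_closure.
rewrite cl /= in_itv /= -ler_norml => h.
by move: (lt_le_trans x43 h); rewrite ltxx.
Qed.

Lemma cutoff_eq1 (x : R) : `|x| <= 3 / 4 -> chi x = 1.
Proof. by rewrite ler_norml; have [_ _ + _] := chi_cutoff; apply. Qed.

Lemma cutoff_ge0 (x : R) : 0 <= chi x.
Proof.
have [_ mono _ _] := chi_cutoff.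
have [x43|x43] := leP `|x| (4 / 3); last by rewrite cutoff_eq0.
rewrite -(@cutoff_eq0 2); last by rewrite ger0_norm//; lra.
by apply: mono; rewrite (le_trans x43)// ger0_norm//; lra.
Qed.

Lemma cutoff_le1 (x : R) : chi x <= 1.
Proof.
have [_ mono _ _] := chi_cutoff.
rewrite -(@cutoff_eq1 0) ?normr0 ?divr_ge0//.
by apply: mono; rewrite normr0.
Qed.

Lemma dyadic_le1 (j : int) (x : R) : `|dyadic chi j x| <= 1.
Proof.
case: j => m /=; last by rewrite ger0_norm ?cutoff_ge0 ?cutoff_le1.
have := cutoff_ge0; have := cutoff_le1.
set y := _ * x => le1 ge0; rewrite ler_norml.
by have := le1 y; have := le1 (y / 2); have := ge0 y; have := ge0 (y / 2); lra.
Qed.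

Lemma dyadic_supp (m : nat) (x : R) : 0 <= x -> dyadic chi m x != 0 ->
  3 / 4 * 2 ^+ m <= x <= 8 / 3 * 2 ^+ m.
Proof.
move=> x0 /=; set y := _ * x => dy; have m0 : 0 < 2 ^+ m :> R by rewrite exprn_gt0.
have y0 : 0 <= y by rewrite mulr_ge0// invr_ge0 ltW.
have -> : x = y * 2 ^+ m by rewrite /y mulrC mulVKf// gt_eqF.
rewrite !ler_pM2r//; apply/andP; split; rewrite leNgt; apply: contra dy => hy.
  by rewrite !cutoff_eq1 ?subrr// ger0_norm ?divr_ge0//; lra.
by rewrite !cutoff_eq0 ?subrr// ger0_norm ?divr_ge0//; lra.
Qed.

Lemma dyadic_suppN1 (m : nat) (x : R) : 0 <= x ->
  dyadic chi (Negz m) x != 0 -> x <= 4 / 3.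
Proof.
move=> x0 /=; rewrite leNgt; apply: contra => hx.
by rewrite cutoff_eq0// ger0_norm.
Qed.

End cutoff.

Lemma torus_Linfty_le (R : realType) n (g : 'rV[R]_n -> R[i]) (B : R) :
  (forall x, ComplexField.Normc.normc (g x) <= B) -> (torus_Linfty g <= B%:E)%E.
Proof.
move=> gB; rewrite /torus_Linfty unlock ifT.
  apply/ess_supP/aeW => t; rewrite /= lee_fin ger0_norm ?gB//.
  by case: (g _) => ? ?; exact: sqrtr_ge0.
by rewrite [X in (_ < X)%E](torus_measureT R n) lte01.
Qed.

(** * Lacunary sine series: Fourier coefficients and Besov norm *)

Definition sine_coef (R : realType) n (s : R) (k : nat -> 'rV[int]_n) i : R :=
  enorm (int_row R (k i)) `^ (- s).

(** The sum is the limit of the partial sums, hence meaningful only when they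
converge; this is the case for lacunary frequencies and [s > 0]. *)
Definition sine_series (R : realType) n (s : R) (k : nat -> 'rV[int]_n)
    (x : 'rV[R]_n) : R :=
  limn (series (fun i =>
    sine_coef s k i * sin (2 * pi * dot (int_row R (k i)) x))).

Section sine_series.
Context (R : realType) (n : nat) (s : R) (k : nat -> 'rV[int]_n).
Hypothesis s0 : 0 < s.
Hypothesis k0 : forall i, k i != 0.
Hypothesis klac : forall i,
  4 * enorm (int_row R (k i)) <= enorm (int_row R (k i.+1)).
Local Notation a := (@sine_coef R n s k).
Local Notation f := (@sine_series R n s k).
Local Notation nk i := (enorm (int_row R (k i))).

Lemma enorm_freq_ge1 i : 1 <= nk i. Proof. exact: enorm_ge1. Qed.

Lemma enorm_freq_gt0 i : 0 < nk i.
Proof. exact: lt_le_trans ltr01 (enorm_freq_ge1 i). Qed.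

Lemma sine_coef_gt0 i : 0 < a i.
Proof. by rewrite powR_gt0// enorm_freq_gt0. Qed.

Lemma enorm_freq_ge i : 4 ^+ i <= nk i.
Proof.
elim: i => [|i ih]; first by rewrite expr0 enorm_freq_ge1.
by rewrite exprS; apply: le_trans (klac i); rewrite ler_pM2l.
Qed.

Lemma enorm_freq_lt i j : (i < j)%N -> 4 * nk i <= nk j.
Proof.
elim: j => // j ih; rewrite ltnS leq_eqVlt => /predU1P[->//|/ih ij].
apply: le_trans ij _; apply: le_trans (klac j).
by rewrite ler_peMl ?enorm_ge0// ler1n.
Qed.

Lemma enorm_freq_inj i j : nk i = nk j -> i = j.
Proof.
move=> e; have gt0 := enorm_freq_gt0 i; have gt0' := enorm_freq_gt0 j.
by have [/enorm_freq_lt ?|/enorm_freq_lt ?|//] := ltngtP i j; exfalso; lra.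
Qed.

Lemma sine_coef_geo i : a i <= (4 `^ (- s)) ^+ i.
Proof.
rewrite /sine_coef -powR_mulrn ?powR_ge0// -powRrM mulrC powRrM powR_mulrn//.
by rewrite powR_anti ?exprn_gt0 ?enorm_freq_ge// ltW.
Qed.

Lemma sine_coef_cvg : cvgn (series a).
Proof.
apply: (@series_le_cvg _ _ (geometric 1 (4 `^ (- s)))).
- by move=> i; exact/ltW/sine_coef_gt0.
- by move=> i /=; rewrite mul1r exprn_ge0// powR_ge0.
- by move=> i /=; rewrite mul1r sine_coef_geo.
apply: is_cvg_geometric_series; rewrite ger0_norm ?powR_ge0//.
rewrite powRN invf_lt1 ?powR_gt0//.
by rewrite /powR gt_eqF// expR_gt1 mulr_gt0// ln_gt0// ltr1n.
Qed.

Lemma sine_term_le i x : `|a i * sin x| <= a i.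
Proof.
rewrite normrM ger0_norm ?powR_ge0//.
by rewrite ler_piMr ?powR_ge0 ?sin_max.
Qed.

Lemma sine_series_continuous : continuous f.
Proof.
apply: (weierstrass_continuous (fun i x => sine_term_le i _) sine_coef_cvg) => i x.
have cs : {for x, continuous (sin \o (fun y => 2 * pi * dot (int_row R (k i)) y))}.
  apply: continuous_comp; last exact: continuous_sin.
  exact: (cvgM (cvg_cst _) (@continuous_dot R n (int_row R (k i)) x)).
exact: (cvgM (cvg_cst _) cs).
Qed.

Lemma sine_series_periodic : Defs.periodic f.
Proof.
move=> x l; congr (limn (series _)); apply/funext => i.
have [m e] := dot_int R (k i) l.
by rewrite dotDr mulrDr e sin_periodZ.
Qed.

(** With phases 0 and pi/2 these are the real and imaginary parts of the Fourier
coefficient of [f] at [l]. *)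
Let pairing l c := torus_int (fun x => f x * cos (2 * pi * dot (int_row R l) x + c)).

Lemma measurable_sine_term i l c :
  measurable_fun setT (fun t : n.-tuple (measurableTypeR R) =>
    a i * sin (2 * pi * dot (int_row R (k i)) (row_of_tuple t)) *
    cos (2 * pi * dot (int_row R l) (row_of_tuple t) + c)).
Proof.
apply: measurable_funM; last exact: measurable_wave (@continuous_cos R).
apply: measurable_funM; first exact: measurable_cst.
under eq_fun do rewrite -[2 * pi * _]addr0.
exact: measurable_wave (@continuous_sin R).
Qed.

Lemma sine_term_cos_le i x y : `|a i * sin x * cos y| <= a i.
Proof.
by rewrite normrM -[leRHS]mulr1 ler_pM// ?sine_term_le// cos_max.
Qed.

Lemma sine_term_int0 i l c : l != k i -> l != - k i ->
  torus_int (fun x => a i * sin (2 * pi * dot (int_row R (k i)) x) *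
    cos (2 * pi * dot (int_row R l) x + c)) = 0.
Proof.
move=> li lNi; rewrite /torus_int.
under eq_Rintegral do rewrite -mulrA.
rewrite RintegralZl//; first by rewrite [X in _ * X]torus_int_sin_cos// mulr0.
apply: (@torus_integrable _ _ 1) => [|t].
  apply: measurable_funM; last exact: measurable_wave (@continuous_cos R).
  under eq_fun do rewrite -[2 * pi * _]addr0.
  exact: measurable_wave (@continuous_sin R).
by rewrite normrM -[leRHS]mulr1 ler_pM// ?sin_max// cos_max.
Qed.

Lemma torus_int_pairing l c :
  series (fun i => torus_int (fun x => a i * sin (2 * pi * dot (int_row R (k i)) x)
     * cos (2 * pi * dot (int_row R l) x + c))) @ \oo --> pairing l c.
Proof.
rewrite /pairing /torus_int.
rewrite (_ : (fun t => f _ * _) =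
    (fun t : n.-tuple (measurableTypeR R) => limn (series (fun i =>
      a i * sin (2 * pi * dot (int_row R (k i)) (row_of_tuple t)) *
      cos (2 * pi * dot (int_row R l) (row_of_tuple t) + c))))); last first.
  apply/funext => t; rewrite mulrC -[LHS]/(_ *: (_ : R^o)) -lim_seriesZ.
    by congr (limn (series _)); apply/funext => i; exact: mulrC.
  exact: weierstrass_cvg (fun i x => sine_term_le i _) sine_coef_cvg _.
apply: (@weierstrass_integral _ _ _ _ _ (fun i (t : n.-tuple (measurableTypeR R)) =>
  a i * sin (2 * pi * dot (int_row R (k i)) (row_of_tuple t))
     * cos (2 * pi * dot (int_row R l) (row_of_tuple t) + c)) a) => //.
- by rewrite [X in (X < _)%E](torus_measureT R n) ltry.
- by move=> i; exact: measurable_sine_term.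
- by move=> i t; exact: sine_term_cos_le.
exact: sine_coef_cvg.
Qed.

(** At most the term of index [i] is not orthogonal to the wave of frequency [l]. *)
Lemma pairing_single (l : 'rV[int]_n) (c : R) (i : nat) :
  (forall j, j != i -> l != k j /\ l != - k j) -> `|pairing l c| <= a i.
Proof.
move=> li; rewrite (cvg_series_single (i := i) _ (@torus_int_pairing l c)).
  apply: torus_int_le => [|x]; first exact: measurable_sine_term.
  exact: sine_term_cos_le.
move=> j /li[lkj lNkj]; exact: sine_term_int0.
Qed.

Lemma pairing_eq0 (l : 'rV[int]_n) (c : R) :
  (forall j, l != k j /\ l != - k j) -> pairing l c = 0.
Proof.
move=> li; rewrite (cvg_series_single (i := 0) _ (@torus_int_pairing l c)).
  by have [? ?] := li 0; exact: sine_term_int0.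
by move=> j _; have [? ?] := li j; exact: sine_term_int0.
Qed.

Lemma sine_series_int0 : torus_int f = 0.
Proof.
have <- : pairing 0 0 = 0.
  by apply: pairing_eq0 => j; rewrite eq_sym k0 eq_sym oppr_eq0 k0.
rewrite /pairing /torus_int; apply: eq_Rintegral => t _.
rewrite /int_row map_mx0 /dot big1 ?mulr0 ?addr0 ?cos0 ?mulr1// => i _.
by rewrite mxE mul0r.
Qed.

Lemma sine_series_fourier (l : 'rV[int]_n) :
  fourier f l = (pairing l 0 +i* pairing l (pi / 2))%C.
Proof.
rewrite /fourier /pairing /torus_int; congr (_ +i* _)%C; apply: eq_Rintegral => t _ /=.
  by rewrite cosN addr0 mul0r subr0.
by rewrite sinN cosDpihalf mul0r addr0.
Qed.

Lemma pairing_le (l : 'rV[int]_n) (c : R) (i : nat) :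
  l = k i \/ l = - k i -> `|pairing l c| <= a i.
Proof.
move=> li; apply: pairing_single => j ji; suff ne : enorm (int_row R l) <> nk j.
  by split; apply/eqP => lj; apply: ne; rewrite lj ?enormN.
move=> e; move/eqP : ji; apply; apply: enorm_freq_inj; rewrite -e.
by case: li => ->; rewrite ?enormN.
Qed.

Section blocks.
Variable chi : R -> R.
Hypothesis chi_cutoff : is_cutoff chi.

(** A dyadic shell has end ratio (8/3) / (3/4) = 32/9 < 4, so lacunarity puts at most
one frequency in it; the lowest block is a ball of radius 4/3, and frequencies
have norm at least 1. *)
Lemma shell_unique j i i' :
  dyadic chi j (nk i) != 0 -> dyadic chi j (nk i') != 0 -> i = i'.
Proof.
wlog ii' : i i' / (i <= i')%N.
  by move=> W hi hi'; have [/W|/ltnW/W] := leqP i i'; [exact|move=> /(_ hi' hi)].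
move: ii'; rewrite leq_eqVlt => /predU1P[//|/enorm_freq_lt ii'].
have i1 := enorm_freq_ge1 i.
case: j => m hi hi'; exfalso; last first.
  by have := dyadic_suppN1 chi_cutoff (enorm_ge0 _) hi'; lra.
have m0 : 0 < 2 ^+ m :> R by rewrite exprn_gt0.
have := dyadic_supp chi_cutoff (enorm_ge0 _) hi.
have := dyadic_supp chi_cutoff (enorm_ge0 _) hi'.
by move=> /andP[_ ?] /andP[? _]; lra.
Qed.

(** For [j = -1] the bound holds because frequencies have norm at least 1. *)
Lemma shell_scale j i : -1 <= j -> dyadic chi j (nk i) != 0 ->
  2 `^ j%:~R <= 4 / 3 * nk i.
Proof.
have i1 := enorm_freq_ge1 i; case: j => m j1 hi.
  rewrite powR_mulrn//; have /andP[? _] := dyadic_supp chi_cutoff (enorm_ge0 _) hi; lra.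
case: m j1 hi => // _ _; rewrite -[(-1)%:~R]/(-1 :> R) powR_inv1//; lra.
Qed.

Lemma lp_term_le j i (l : 'rV[int]_n) x : l = k i \/ l = - k i ->
  ComplexField.Normc.normc ((dyadic chi j (enorm (int_row R l)))%:C * fourier f l *
      expi (2 * pi * dot (int_row R l) x))%C <= 2 * a i.
Proof.
move=> li; rewrite !ComplexField.Normc.normcM normc_expi mulr1 normc_real.
apply: (@le_trans _ _ (1 * (a i + a i))); last by rewrite mul1r mulr_natl mulr2n.
apply: ler_pM => //; last 1 first.
- rewrite sine_series_fourier; apply: le_trans (normc_le _ _) _.
  by apply: lerD; exact: pairing_le.
- by rewrite /ComplexField.Normc.normc; case: fourier => ? ?; exact: sqrtr_ge0.
- exact: dyadic_le1.
Qed.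

Lemma lp_term_eq0 j (l : 'rV[int]_n) x :
  (forall i, dyadic chi j (nk i) != 0 -> l != k i /\ l != - k i) ->
  ((dyadic chi j (enorm (int_row R l)))%:C * fourier f l *
      expi (2 * pi * dot (int_row R l) x))%C = 0.
Proof.
move=> h; have [dl|dl] := eqVneq (dyadic chi j (enorm (int_row R l))) 0.
  by rewrite dl !mul0r.
suff -> : fourier f l = 0 by rewrite mulr0 mul0r.
have hl i : l != k i /\ l != - k i.
  have [di|/h//] := eqVneq (dyadic chi j (nk i)) 0.
  by split; apply: contra dl => /eqP ->; rewrite ?enormN di.
by rewrite sine_series_fourier !pairing_eq0.
Qed.

(** A block is either zero or the sum of the two terms at [k i] and [- k i], for the
only frequency in its shell; the scale 2^j is then comparable to |k_i|, so the
weight 2^(js) is compensated by the amplitude |k_i|^(-s). *)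
Lemma lp_block_bound (j : int) : -1 <= j -> exists B,
  (forall x, ComplexField.Normc.normc (lp_block chi f j x) <= B) /\
  2 `^ (j%:~R * s) * B <= 4 * (4 / 3) `^ s.
Proof.
move=> j1.
have [[i hi]|none] := pselect (exists i, dyadic chi j (nk i) != 0); last first.
  exists 0; split=> [x|]; last by rewrite mulr0 mulr_ge0 ?powR_ge0.
  rewrite /lp_block fsbig1 ?ComplexField.Normc.normc0// => l _.
  by apply: lp_term_eq0 => i hi; exfalso; apply: none; exists i.
exists (4 * a i); split=> [x|].
  rewrite /lp_block -(fsbig_widen [set` [:: k i; - k i]])//=; last first.
    move=> l [_ /= /negP nl]; move: nl; rewrite !inE negb_or => /andP[li lNi].
    by apply: lp_term_eq0 => i' hi'; rewrite -(shell_unique hi hi').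
  rewrite -fsbig_seq//=; last first.
    rewrite inE andbT; apply: contra (k0 i) => /eqP/rowP e.
    apply/eqP/rowP => m; have := e m; rewrite !mxE => /eqP.
    by rewrite -addr_eq0 -mulr2n mulrn_eq0 => /eqP.
  rewrite !big_cons big_nil addr0.
  apply: le_trans (le_normcD _ _) _.
  rewrite (_ : 4 * a i = 2 * a i + 2 * a i); last by ring.
  by apply: lerD; apply: lp_term_le; [left|right].
rewrite mulrCA ler_pM2l//.
apply: (@le_trans _ _ ((4 / 3 * nk i) `^ s * a i)).
  rewrite ler_wpM2r ?powR_ge0// powRrM powR_homo ?powR_ge0 ?shell_scale// ltW//.
rewrite powRM ?enorm_ge0 ?divr_ge0// -mulrA ler_piMr ?powR_ge0//.
by rewrite /sine_coef powRN divff// gt_eqF// powR_gt0// enorm_freq_gt0.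
Qed.

Lemma sine_series_besov : besov chi s f.
Proof.
split; [exact: sine_series_continuous|exact: sine_series_periodic|].
apply: (@le_lt_trans _ _ (4 * (4 / 3) `^ s)%:E); last exact: ltry.
apply: ge_ereal_sup => _ [j /= j1 <-].
have [B [blk sB]] := lp_block_bound j1.
apply: (@le_trans _ _ ((2 `^ (j%:~R * s))%:E * B%:E)%E).
  by apply: lee_wpmul2l; [rewrite lee_fin powR_ge0|exact: torus_Linfty_le].
by rewrite -EFinM lee_fin.
Qed.

End blocks.

(** * Time averages along a line *)

Section line_average.
Variable (w : 'rV[R]_n) (T : R).
Hypothesis w0 : forall i, 0 < dot (int_row R (k i)) w.
Hypothesis T0 : 0 < T.
Local Notation phase i := (2 * pi * dot (int_row R (k i)) w * T).

Lemma phase_gt0 i : 0 < phase i.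
Proof. by rewrite !mulr_gt0 ?pi_gt0. Qed.

Lemma line_average_cvg :
  series (fun i => a i * ((1 - cos (phase i)) / phase i)) @ \oo -->
    line_average f w T.
Proof.
have lin i t : 2 * pi * dot (int_row R (k i)) (t *: w) =
    2 * pi * dot (int_row R (k i)) w * t by rewrite dotZr; ring.
have csin (b : R) : continuous (sin \o ( *%R b : R -> R)).
  move=> x; apply: continuous_comp; last exact: continuous_sin.
  exact: mulrl_continuous.
have h : series (fun i => \int[lebesgue_measure]_(t in `[0, T])
    (a i * sin (2 * pi * dot (int_row R (k i)) (t *: w)))) @ \oo -->
    \int[lebesgue_measure]_(t in `[0, T]) f (t *: w).
  apply: (@weierstrass_integral _ _ _ _ _ (fun i (t : measurableTypeR R) =>
    a i * sin (2 * pi * dot (int_row R (k i)) (t *: w))) a) => //.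
  - by rewrite /= lebesgue_measure_itv/= lte_fin T0 -EFinB ltry.
  - move=> i; apply: measurable_funM; first exact: measurable_cst.
    by under eq_fun do rewrite lin; exact: continuous_measurable_fun (csin _).
  - by move=> i t; exact: sine_term_le.
  - exact: sine_coef_cvg.
rewrite /line_average.
rewrite (_ : series _ = (fun N => T^-1 *
    series (fun i => \int[lebesgue_measure]_(t in `[0, T])
      (a i * sin (2 * pi * dot (int_row R (k i)) (t *: w)))) N)).
  exact: (cvgM (cvg_cst _) h).
apply/funext => N; rewrite /series /= mulr_sumr; apply: eq_bigr => i _.
have b0 : 2 * pi * dot (int_row R (k i)) w != 0.
  by rewrite gt_eqF// !mulr_gt0 ?pi_gt0.
under eq_Rintegral do rewrite lin.
rewrite RintegralZl//; last first.
  apply: (@bounded_integrable _ _ _ _ _ 1) => //.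
  - by rewrite /= lebesgue_measure_itv/= lte_fin T0 -EFinB ltry.
  - by apply: measurable_funTS; exact: continuous_measurable_fun (csin _).
  - by move=> x; exact: sin_max.
rewrite integral_sin// [RHS]mulrCA; congr (_ * _).
by rewrite invfM mulrA [RHS]mulrC.
Qed.

Lemma line_term_ge0 i : 0 <= a i * ((1 - cos (phase i)) / phase i).
Proof.
rewrite mulr_ge0 ?powR_ge0// divr_ge0 ?subr_ge0 ?cos_le1//.
exact/ltW/phase_gt0.
Qed.

(** All terms are nonnegative and the mean of [f] is zero, so the absolute value in
the discrepancy disappears. *)
Lemma discrepancyE : discrepancy f w T =
  limn (series (fun i => a i * ((1 - cos (phase i)) / phase i))).
Proof.
have h := line_average_cvg.
rewrite /discrepancy sine_series_int0 subr0 (cvg_lim (@norm_hausdorff _ _) h).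
rewrite ger0_norm// -(cvg_lim (@norm_hausdorff _ _) h).
apply: limr_ge; first by apply/cvg_ex; eexists; exact: h.
by apply: nearW => N; apply: sumr_ge0 => i _; exact: line_term_ge0.
Qed.

Lemma discrepancy_ge N :
  series (fun i => a i * ((1 - cos (phase i)) / phase i)) N <= discrepancy f w T.
Proof.
rewrite discrepancyE; apply: nondecreasing_cvgn_le.
  by apply: nondecreasing_series => i _ _; exact: line_term_ge0.
by apply/cvg_ex; eexists; exact: line_average_cvg.
Qed.

Lemma discrepancy_ge_term i :
  a i * ((1 - cos (phase i)) / phase i) <= discrepancy f w T.
Proof.
apply: le_trans (discrepancy_ge i.+1).
rewrite /series /= big_nat_recr//= lerDr.
by apply: sumr_ge0 => j _; exact: line_term_ge0.
Qed.

Lemma discrepancy_le (B : R) :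
  (forall N, series (fun i => a i * ((1 - cos (phase i)) / phase i)) N <= B) ->
  discrepancy f w T <= B.
Proof.
move=> h; rewrite discrepancyE; apply: limr_le; last exact: nearW.
by apply/cvg_ex; eexists; exact: line_average_cvg.
Qed.

End line_average.
End sine_series.

(** * Single frequencies and exact Diophantine index *)

Lemma times_to_infty_powR (R : realType) n (k : nat -> 'rV[int]_n)
    (c sigma : R) (T : nat -> R) : 0 < c -> 0 < sigma ->
  (forall i, k i != 0) ->
  (forall i, 4 * enorm (int_row R (k i)) <= enorm (int_row R (k i.+1))) ->
  (forall j, c * enorm (int_row R (k j)) `^ sigma <= T j) ->
  times_to_infty T.
Proof.
move=> c0 sigma0 k0 klac kT; split=> [j|].
  apply: lt_le_trans (kT j); rewrite mulr_gt0// powR_gt0//.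
  exact: lt_le_trans ltr01 (enorm_ge1 _ (k0 j)).
apply/cvgryPge => A; pose B := Num.max (A / c) 0.
near=> j; apply: le_trans (kT j); rewrite -ler_pdivrMl// mulrC.
apply: (@le_trans _ _ B); first by rewrite le_max lexx.
have B0 : 0 <= B by rewrite le_max lexx orbT.
have -> : B = (B `^ sigma^-1) `^ sigma by rewrite -powRrM mulVf ?gt_eqF// powRr1.
apply: powR_homo; rewrite ?powR_ge0//; first exact: ltW.
apply: (@le_trans _ _ j%:R); first by near: j; exact: nbhs_infty_ger.
apply: le_trans (enorm_freq_ge k0 klac j).
by rewrite -natrX ler_nat ltnW// ltn_expl.
Unshelve. all: by end_near. Qed.

(** Choosing each frequency beyond [A] times the previous one turns a property that
holds for arbitrarily large frequencies into a lacunary sequence. *)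
Lemma lacunary_choice (R : realType) n (P : 'rV[int]_n -> Prop) (A M0 : R) :
  (forall M : R, exists k, P k /\ M <= enorm (int_row R k)) ->
  exists k : nat -> 'rV[int]_n, [/\ forall i, P (k i),
    forall i, A * enorm (int_row R (k i)) <= enorm (int_row R (k i.+1)) &
    M0 <= enorm (int_row R (k 0))].
Proof.
move=> /choice[g gP].
exists (fix k i := if i is j.+1 then g (A * enorm (int_row R (k j))) else g M0).
by split=> [[|i]|i|]; [exact: (gP _).1|exact: (gP _).1|exact: (gP _).2|exact: (gP _).2].
Qed.

Lemma dot_neq0 (R : realType) n (w : 'rV[R]_n) (k : 'rV[int]_n) :
  dot (int_row R k) w != 0 -> k != 0.
Proof.
apply: contra => /eqP ->.
by rewrite /int_row map_mx0 /dot big1// => i _; rewrite mxE mul0r.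
Qed.

(** Replacing [k] by [- k] when necessary makes all terms of the time average
nonnegative. *)
Lemma positive_sign (R : realType) n (w : 'rV[R]_n) (k : 'rV[int]_n) :
  dot (int_row R k) w != 0 -> exists l, [/\ enorm (int_row R l) = enorm (int_row R k),
    0 < dot (int_row R l) w &
    dot (int_row R l) w = `|dot (int_row R k) w|].
Proof.
move=> kw; have [kw0|kw0] := ltP 0 (dot (int_row R k) w).
  by exists k; split=> //; rewrite gtr0_norm.
have {}kw0 : dot (int_row R k) w < 0 by rewrite lt_neqAle kw.
exists (- k); rewrite enormN int_rowN dotNl oppr_gt0 ltr0_norm//.
Qed.

Section half_period.
Context (R : realType) (n : nat) (s : R) (k : nat -> 'rV[int]_n) (w : 'rV[R]_n).
Hypothesis s0 : 0 < s.
Hypothesis k0 : forall i, k i != 0.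
Hypothesis klac : forall i,
  4 * enorm (int_row R (k i)) <= enorm (int_row R (k i.+1)).
Hypothesis w0 : forall i, 0 < dot (int_row R (k i)) w.

(** At the half period of the i-th wave its sine has stayed nonnegative, and its
average is 2 / pi. *)
Lemma discrepancy_half_period i :
  2 / pi * sine_coef s k i <=
  discrepancy (sine_series s k) w (1 / (2 * dot (int_row R (k i)) w)).
Proof.
have wi := w0 i.
have T0 : 0 < 1 / (2 * dot (int_row R (k i)) w) by rewrite divr_gt0// mulr_gt0.
apply: le_trans (discrepancy_ge_term s0 k0 klac w0 T0 i).
have -> : 2 * pi * dot (int_row R (k i)) w * (1 / (2 * dot (int_row R (k i)) w)) = pi.
  by field; rewrite gt_eqF.
by rewrite cospi opprK mulrC.
Qed.

End half_period.

(** The times are the odd multiples of the half period of the wave [k 0]: there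
[1 - cos] has its maximal value 2, whatever the size of the time. *)
Lemma single_frequency_rate (R : realType) n (chi : R -> R) (w : 'rV[R]_n)
    (l : 'rV[int]_n) (s : R) : is_cutoff chi ->
  dot (int_row R l) w != 0 -> 0 < s ->
  exists (f : 'rV[R]_n -> R) (C : R) (T : nat -> R),
    [/\ besov chi s f, 0 < C, times_to_infty T &
        forall j : nat, C * (1 / T j) <= discrepancy f w (T j)].
Proof.
move=> chic lw s0.
have [e [_ ew _]] := positive_sign lw.
pose k i := e *+ (4 ^ i).
have kw i : 0 < dot (int_row R (k i)) w.
  by rewrite int_rowMn dotZl mulr_gt0// ltr0n expn_gt0.
have k0 i : k i != 0 by apply: (@dot_neq0 _ _ w); rewrite gt_eqF.
have klac i : 4 * enorm (int_row R (k i)) <= enorm (int_row R (k i.+1)).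
  by rewrite /k !int_rowMn !enormZ// expnS natrM mulrA.
have th0 := kw 0.
set th := dot (int_row R (k 0)) w in th0.
have a0 := sine_coef_gt0 s k0 0.
pose T (j : nat) : R := (2 * j%:R + 1) / (2 * th).
have T0 j : 0 < T j by rewrite divr_gt0 ?mulr_gt0// ltr_wpDl// mulr_ge0.
exists (sine_series s k), (sine_coef s k 0 / (pi * th)), T; split.
- exact: sine_series_besov.
- by rewrite divr_gt0 ?mulr_gt0 ?pi_gt0.
- split=> //; apply/cvgryPge => A; near=> j.
  rewrite ler_pdivlMr ?mulr_gt0//.
  have : A * (2 * th) <= j%:R by near: j; exact: nbhs_infty_ger.
  have : 0 <= j%:R :> R by [].
  lra.
- move=> j; apply: le_trans (discrepancy_ge_term s0 k0 klac kw (T0 j) 0).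
  rewrite -/th.
  have -> : 2 * pi * th * T j = pi + 2 * pi * (j : int)%:~R.
    by rewrite /T -pmulrn; field; rewrite gt_eqF.
  rewrite -sinDpihalf addrAC sin_periodZ sinDpihalf cospi opprK.
  rewrite le_eqVlt; apply/orP; left; apply/eqP.
  rewrite /T -pmulrn; have := pi_gt0 R; move: (sine_coef s k 0) (@pi R) => a p p0.
  have j0 : 0 <= j%:R :> R by [].
  have j1 : 0 < 2 * j%:R + 1 :> R by lra.
  have pj : 0 < p + 2 * p * j%:R by rewrite ltr_wpDr// !mulr_ge0// ltW.
  by field; rewrite !gt_eqF.
Unshelve. all: by end_near. Qed.

Lemma exact_index_rate (R : realType) n (chi : R -> R) (sigma Cw : R)
    (w : 'rV[R]_n) (s : R) : is_cutoff chi -> 0 < sigma -> 0 < Cw ->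
  exact_index sigma Cw w -> 0 < s ->
  exists (f : 'rV[R]_n -> R) (C : R) (T : nat -> R),
    [/\ besov chi s f, 0 < C, times_to_infty T &
        forall j : nat, C * (1 / T j) `^ (s / sigma) <= discrepancy f w (T j)].
Proof.
move=> chic sigma0 Cw0 [C' [k' [C'0 k'0 k'oo k'w]]] s0.
pose P (k : 'rV[int]_n) := 0 < dot (int_row R k) w <=
  C' * enorm (int_row R k) `^ (- sigma).
have exP M : exists k, P k /\ M <= enorm (int_row R k).
  have /cvgryPge/(_ M)[j _ /(_ j (leqnn j)) jM] := k'oo.
  have /andP[lo hi] := k'w j.
  have kw : dot (int_row R (k' j)) w != 0.
    rewrite -normr_gt0; apply: lt_le_trans lo.
    by rewrite mulr_gt0// powR_gt0// (lt_le_trans ltr01)// enorm_ge1.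
  have [l [le lw0 lw]] := positive_sign kw.
  by exists l; rewrite /P lw0 lw le hi.
have [k [kP klac _]] := lacunary_choice 4 0 exP.
have kw i : 0 < dot (int_row R (k i)) w by have /andP[] := kP i.
have k0 i : k i != 0 by apply: (@dot_neq0 _ _ w); rewrite gt_eqF.
have nk0 i : 0 < enorm (int_row R (k i)) by rewrite (lt_le_trans ltr01)// enorm_ge1.
exists (sine_series s k), (2 / pi / (2 * C') `^ (s / sigma)),
  (fun j => 1 / (2 * dot (int_row R (k j)) w)); split.
- exact: sine_series_besov.
- by rewrite !divr_gt0 ?pi_gt0 ?powR_gt0 ?mulr_gt0.
- apply: (@times_to_infty_powR _ _ k (2 * C')^-1 sigma) => //.
    by rewrite invr_gt0 mulr_gt0.
  move=> j; have /andP[_ hi] := kP j.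
  rewrite div1r -[X in _ * X]invrK -invfM lef_pV2 ?posrE; last 2 first.
  - by rewrite !mulr_gt0 ?invr_gt0 ?powR_gt0.
  - by rewrite mulr_gt0.
  by rewrite -powRN -mulrA ler_pM2l.
- move=> j; apply: le_trans (discrepancy_half_period s0 k0 klac kw j).
  have /andP[_ hi] := kP j.
  rewrite -[leLHS]mulrA ler_pM2l ?divr_gt0 ?pi_gt0// ler_pdivrMl ?powR_gt0 ?mulr_gt0//.
  rewrite div1r div1r invrK.
  apply: (@le_trans _ _
    ((2 * C' * enorm (int_row R (k j)) `^ (- sigma)) `^ (s / sigma))).
    apply: powR_homo.
    - by rewrite divr_ge0// ltW.
    - by rewrite mulr_ge0// ltW.
    - by rewrite -mulrA ler_pM2l.
  rewrite powRM ?powR_ge0//; last by rewrite mulr_ge0// ltW.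
  rewrite -powRrM /sine_coef.
  by rewrite mulNr mulrCA divff ?gt_eqF// mulr1.
Qed.

(** * Dirichlet approximation and badly approximable vectors *)

(** Pigeonhole: the (Q+1)^2 values [p1 x + p2 y] with 0 <= p1, p2 <= Q lie in an
interval of length Q (x + y), which Q^2 + 1 boxes of width (x + y) / Q cover; two
of the values share a box, and their difference is the required combination. *)
Lemma dirichlet_ge0 (R : realType) (x y : R) (Q : nat) : 0 <= x -> 0 <= y ->
  (0 < Q)%N -> exists a b : int, [/\ (a != 0) || (b != 0),
    `|a%:~R| <= Q%:R :> R, `|b%:~R| <= Q%:R :> R &
    `|a%:~R * x + b%:~R * y| <= (x + y) / Q%:R].
Proof.
move=> x0 y0 Q0; have Q0R : 0 < Q%:R :> R by rewrite ltr0n.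
have := addr_ge0 x0 y0; rewrite le_eqVlt => /predU1P[/esym/eqP|S0].
  rewrite paddr_eq0// => /andP[/eqP -> /eqP ->]; exists 1, 0.
  by split; rewrite ?normr1 ?normr0 ?ler1n ?mulr0 ?addr0 ?normr0 ?mul0r.
pose v (p : 'I_Q.+1 * 'I_Q.+1) : R := p.1%:R * x + p.2%:R * y.
have le_Q (i : 'I_Q.+1) : i%:R <= Q%:R :> R by rewrite ler_nat -ltnS.
have v0 p : 0 <= v p by rewrite addr_ge0// mulr_ge0.
pose h := (x + y) / Q%:R; have h0 : 0 < h by rewrite divr_gt0.
have vh p : 0 <= v p / h by exact: divr_ge0 (v0 p) (ltW h0).
have vQ p : (Num.truncn (v p / h) < (Q * Q).+1)%N.
  rewrite truncn_lt_nat//.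
  apply: (@le_lt_trans _ _ (Q * Q)%:R); last by rewrite ltr_nat.
  rewrite ler_pdivrMr// natrM.
  have -> : Q%:R * Q%:R * h = Q%:R * (x + y) by rewrite /h; field; rewrite gt_eqF.
  by rewrite mulrDr lerD// ler_wpM2r.
pose bin p := Ordinal (vQ p).
have /injectivePn[p [q pq binpq]] : ~~ injectiveb bin.
  apply/injectiveP => /leq_card; rewrite card_prod !card_ord leqNgt => /negP; apply.
  by rewrite mulSn mulnS addSn ltnS ltn_addl// -[ltnLHS]add0n ltn_add2r.
exists (p.1%:Z - q.1%:Z), (p.2%:Z - q.2%:Z); split.
- rewrite !subr_eq0 !eqz_nat -negb_and; apply: contra pq => /andP[/eqP e1 /eqP e2].
  by apply/eqP; case: p q e1 e2 {binpq} => [p1 p2] [q1 q2] /= /val_inj -> /val_inj ->.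
- rewrite intrD rmorphN /= ler_norml -!pmulrn.
  have := le_Q p.1; have := le_Q q.1; have := ler0n R p.1; have := ler0n R q.1; lra.
- rewrite intrD rmorphN /= ler_norml -!pmulrn.
  have := le_Q p.2; have := le_Q q.2; have := ler0n R p.2; have := ler0n R q.2; lra.
have e : (p.1%:Z - q.1%:Z)%:~R * x + (p.2%:Z - q.2%:Z)%:~R * y = v p - v q.
  by rewrite /v !intrD !rmorphN /= -!pmulrn; ring.
rewrite e -/h.
have /andP[p1 p2] := truncn_itv (vh p).
have /andP[q1 q2] := truncn_itv (vh q).
have e' : Num.truncn (v p / h) = Num.truncn (v q / h) by case: binpq.
rewrite -e' in q1 q2.
rewrite ler_pdivlMr// in p1; rewrite ler_pdivlMr// in q1.
rewrite ltr_pdivrMr// -[_.+1]addn1 natrD in p2.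
rewrite ltr_pdivrMr// -[_.+1]addn1 natrD in q2.
by clear -p1 p2 q1 q2; rewrite ler_norml; lra.
Qed.

Lemma dirichlet_row (R : realType) n (w : 'rV[R]_n) (i0 i1 : 'I_n) (Q : nat) :
  i0 != i1 -> (0 < Q)%N -> exists k : 'rV[int]_n,
  [/\ enorm (int_row R k) <= 2 * Q%:R,
      `|dot (int_row R k) w| <= (`|w 0 i0| + `|w 0 i1|) / Q%:R &
      exists a b : int, [/\ (a != 0) || (b != 0), k != 0 &
        dot (int_row R k) w = a%:~R * w 0 i0 + b%:~R * w 0 i1]].
Proof.
move=> i01 Q0.
have [a [b [ab aQ bQ abw]]] :=
  dirichlet_ge0 (normr_ge0 (w 0 i0)) (normr_ge0 (w 0 i1)) Q0.
have sg (c : int) (z : R) : exists c' : int, [/\ (c' != 0) = (c != 0),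
    `|c'%:~R| = `|c%:~R| :> R & c'%:~R * z = c%:~R * `|z|].
  have [z0|z0] := leP 0 z; first by exists c; rewrite (ger0_norm z0).
  by exists (- c); rewrite oppr_eq0 rmorphN /= normrN (ltr0_norm z0) mulNr mulrN.
have [a' [a'0 a'Q a'w]] := sg a (w 0 i0).
have [b' [b'0 b'Q b'w]] := sg b (w 0 i1).
rewrite -a'Q -b'Q -a'w -b'w -a'0 -b'0 in ab aQ bQ abw.
pose k : 'rV[int]_n := \row_i (if i == i0 then a' else if i == i1 then b' else 0).
have two (g : 'I_n -> R) : (forall i, i != i0 -> i != i1 -> g i = 0) ->
    \sum_i g i = g i0 + g i1.
  move=> g0; rewrite (bigD1 i0)//= (bigD1 i1) 1?eq_sym//= big1 ?addr0// => i.
  by move=> /andP[? ?]; exact: g0.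
have ki0 : k 0 i0 = a' by rewrite mxE eqxx.
have ki1 : k 0 i1 = b' by rewrite mxE eqxx eq_sym (negbTE i01).
have kiE i : i != i0 -> i != i1 -> k 0 i = 0.
  by move=> ? ?; rewrite mxE !ifN.
have kR i : int_row R k 0 i = (k 0 i)%:~R by rewrite [LHS]mxE.
have kw : dot (int_row R k) w = a'%:~R * w 0 i0 + b'%:~R * w 0 i1.
  rewrite /dot two => [|i ? ?]; first by rewrite !kR ki0 ki1.
  by rewrite kR kiE// mul0r.
exists k; split.
- rewrite /enorm two => [|i ? ?]; last by rewrite kR kiE// expr0n.
  rewrite !kR ki0 ki1 -[leRHS]ger0_norm ?mulr_ge0// -sqrtr_sqr ler_wsqrtr//.
  rewrite -(real_normK (num_real a'%:~R)) -(real_normK (num_real b'%:~R)).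
  apply: (@le_trans _ _ (Q%:R ^+ 2 + Q%:R ^+ 2)).
    by rewrite lerD// lerXn2r// nnegrE.
  by rewrite exprMn; have := sqr_ge0 (Q%:R : R); lra.
- by rewrite kw.
exists a', b'; split=> //.
apply: contraTneq ab => k0; move: ki0 ki1; rewrite k0 !mxE => <- <-.
by rewrite eqxx.
Qed.

(** By the mean value theorem for a primitive [G] of the sum on [X, 2X], some value
of the sum equals its average.  Each term 1 - cos(b_i t) has average at least
1 - 2 / (b_i X) >= 1/2. *)
Lemma resonant_time (R : realType) (b : nat -> R) (N : nat) (X : R) : 0 < X ->
  (forall i, (i < N)%N -> 0 < b i /\ 4 <= b i * X) ->
  exists2 T, X <= T <= 2 * X & N%:R / 2 <= \sum_(0 <= i < N) (1 - cos (b i * T)).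
Proof.
move=> X0 bX.
pose G (t : R) := \sum_(0 <= i < N) (t - (b i)^-1 * sin (b i * t + 0)).
pose g (t : R) := \sum_(0 <= i < N) (1 - (b i)^-1 * (b i * cos (b i * t + 0))).
have dG (t : R) : is_derive t 1 G (g t).
  rewrite /G /g !big_mkord.
  rewrite (_ : (fun t0 => _) =
    \sum_(i < N) (fun t : R => t - (b i)^-1 * sin (b i * t + 0))); last first.
    by apply/funext => u; rewrite fct_sumE big_mkord.
  apply: is_derive_sum => i.
  have h := is_derive_sin_affine (b i) 0 t.
  by apply: is_derive_eq; rewrite /GRing.scale /=.
have X2X : X < 2 * X by lra.
have cG : {within `[X, 2 * X], continuous G}.
  apply: continuous_subspaceT => t.
  by apply/differentiable_continuous/derivable1_diffP; have [] := dG t.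
have [T TX GT] := MVT X2X (fun t _ => dG t) cG.
exists T; first by move: TX; rewrite in_itv /= => /andP[? ?]; rewrite !ltW.
have -> : \sum_(0 <= i < N) (1 - cos (b i * T)) = g T.
  apply: eq_big_nat => i /andP[_ iN]; have [bi _] := bX i iN.
  by rewrite addr0 mulKf ?gt_eqF.
rewrite -(ler_pM2r X0).
have -> : g T * X = G (2 * X) - G X by rewrite GT; ring.
rewrite /G -sumrB.
have -> : N%:R / 2 * X = \sum_(0 <= i < N) (X / 2).
  by rewrite sumr_const_nat subn0 -mulr_natl; field.
apply: ler_sum_nat => i /andP[_ iN]; have [bi biX] := bX i iN.
have bV : (b i)^-1 <= X / 4.
  by rewrite -[_^-1]mul1r ler_pdivrMr// mulrAC ler_pdivlMr// mul1r mulrC.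
have := sin_le1 (b i * (2 * X) + 0); have := sin_geN1 (b i * X + 0).
have bV0 : 0 < (b i)^-1 by rewrite invr_gt0.
set u := sin _; set v := sin _ => hv hu.
have : (b i)^-1 * (v - u) <= (b i)^-1 * 2 by rewrite ler_pM2l//; lra.
rewrite mulrBr; lra.
Qed.

(** Dirichlet's argument on two coordinates gives |k . w| of order 1 / |k|, which
matches the Diophantine lower bound with exponent 1. *)
Lemma badly_approximable_rate (R : realType) n (chi : R -> R) (Cw : R)
    (w : 'rV[R]_n) (i0 i1 : 'I_n) : is_cutoff chi -> i0 != i1 ->
  0 < Cw -> diophantine 1 Cw w ->
  exists (f : 'rV[R]_n -> R) (C : R) (T : nat -> R),
    [/\ besov chi 1 f, 0 < C, times_to_infty T &
        forall j : nat, C * (ln (T j) / T j) <= discrepancy f w (T j)].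
Proof.
move=> chic i01 Cw0 dw; pose S : R := `|w 0 i0| + `|w 0 i1|.
have exk (Q : nat) : (0 < Q)%N -> exists k : 'rV[int]_n,
    [/\ enorm (int_row R k) <= 2 * Q%:R, k != 0,
      0 < dot (int_row R k) w <= S / Q%:R &
      Cw <= dot (int_row R k) w * enorm (int_row R k)].
  move=> Q0; have [k [kQ kw [_ [_ [_ k0 _]]]]] := dirichlet_row w i01 Q0.
  have nk0 : 0 < enorm (int_row R k) by rewrite (lt_le_trans ltr01)// enorm_ge1.
  have := dw _ k0; rewrite powR_inv1 ?enorm_ge0// ler_pdivrMr// => dk.
  have kw0 : dot (int_row R k) w != 0.
    by apply: contraTneq dk => ->; rewrite normr0 mul0r -ltNge.
  have [l [lk lw0 lw]] := positive_sign kw0.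
  exists l; rewrite lk lw0 lw; split=> //.
  by apply: (@dot_neq0 _ _ w); rewrite gt_eqF.
have S0 : 0 < S.
  have [k [_ _ /andP[k1 k2] _]] := exk 1%N isT.
  by move: (lt_le_trans k1 k2); rewrite divr1.
(* 8 S / Cw = 4 * 2 * (S / Cw): a factor 4 for lacunarity, and the ratio 2 S / Cw
   between the upper and lower bounds of |k_i| / A^i. *)
pose A := (Num.truncn (8 * S / Cw)).+1.
have hA : 8 * S / Cw < A%:R by exact: truncnS_gt.
have A0 : 0 < A%:R :> R by rewrite ltr0n.
have /choice[k kP] : forall i, exists l : 'rV[int]_n,
    [/\ enorm (int_row R l) <= 2 * (A ^ i)%:R, l != 0,
      0 < dot (int_row R l) w <= S / (A ^ i)%:R &
      Cw <= dot (int_row R l) w * enorm (int_row R l)].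
  by move=> i; apply: exk; rewrite expn_gt0.
have k0 i : k i != 0 by have [] := kP i.
have nk0 i : 0 < enorm (int_row R (k i)) by rewrite (lt_le_trans ltr01)// enorm_ge1.
have kw i : 0 < dot (int_row R (k i)) w by have [_ _ /andP[]] := kP i.
have Qi0 i : 0 < (A ^ i)%:R :> R by rewrite ltr0n expn_gt0.
have klow i : Cw * (A ^ i)%:R <= S * enorm (int_row R (k i)).
  have [_ _ /andP[_ h1] h2] := kP i.
  rewrite -ler_pdivlMr//; apply: le_trans h2 _.
  by rewrite mulrAC ler_pM2r.
have kthe i : dot (int_row R (k i)) w * enorm (int_row R (k i)) <= 2 * S.
  have [h1 _ /andP[_ h2] _] := kP i.
  apply: (@le_trans _ _ (S / (A ^ i)%:R * (2 * (A ^ i)%:R))).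
    by apply: ler_pM => //; exact: ltW.
  by rewrite mulrCA -mulrA mulVf ?gt_eqF// mulr1.
have klac i : 4 * enorm (int_row R (k i)) <= enorm (int_row R (k i.+1)).
  rewrite -(ler_pM2l S0); apply: le_trans (klow i.+1).
  have [h1 _ _ _] := kP i.
  apply: (@le_trans _ _ (S * (8 * (A ^ i)%:R))).
    by rewrite ler_pM2l//; lra.
  rewrite expnS natrM !mulrA ler_pM2r//; move: hA.
  by rewrite ltr_pdivrMr// => /ltW; rewrite mulrC [X in _ -> _ <= X]mulrC.
have kmono i N : (i <= N)%N -> enorm (int_row R (k i)) <= enorm (int_row R (k N)).
  rewrite leq_eqVlt => /predU1P[->//|/(enorm_freq_lt klac)].
  by have := nk0 i; lra.
(* The Diophantine condition makes X N at least one period of each wave i <= N. *)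
pose X N := enorm (int_row R (k N)) / Cw.
have X0 N : 0 < X N by rewrite divr_gt0.
have exT N : exists T, X N <= T <= 2 * X N /\
    N.+1%:R / 2 <=
      \sum_(0 <= i < N.+1) (1 - cos (2 * pi * dot (int_row R (k i)) w * T)).
  have [|T T1 T2] := @resonant_time _
    (fun i => 2 * pi * dot (int_row R (k i)) w) N.+1 (X N) (X0 N).
    move=> i iN; split; first by rewrite !mulr_gt0 ?pi_gt0.
    have h1 : 1 <= dot (int_row R (k i)) w * X N.
      rewrite /X mulrA ler_pdivlMr// mul1r.
      have [_ _ _ h2] := kP i; apply: le_trans h2 _.
      by rewrite ler_pM2l// kmono.
    by rewrite -mulrA; have := pi_ge2 R; nra.
  by exists T.
have [T TP] := choice exT.
have T0 N : 0 < T N by have [/andP[h _] _] := TP N; exact: lt_le_trans (X0 N) h.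
(* T N <= (4 / Cw) A^N, so ln (T N) is at most D (N + 1). *)
pose D : R := `|ln (4 / Cw)| + ln A%:R + 1.
have lnA : 0 <= ln A%:R :> R by rewrite ln_ge0// ler1n.
have D0 : 0 < D by rewrite ltr_wpDl// addr_ge0.
have lnT N : ln (T N) <= D * N.+1%:R.
  have [/andP[_ h] _] := TP N.
  have [h1 _ _ _] := kP N.
  have hT : T N <= 4 / Cw * A%:R ^+ N.
    apply: le_trans h _; rewrite /X mulrA ler_pdivrMr//.
    rewrite -natrX.
    have -> : 4 / Cw * (A ^ N)%:R * Cw = 4 * (A ^ N)%:R by field; rewrite gt_eqF.
    lra.
  have p4 : 0 < 4 / Cw by rewrite divr_gt0.
  apply: (@le_trans _ _ (ln (4 / Cw * A%:R ^+ N))).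
    by rewrite ler_ln ?posrE// mulr_gt0 ?exprn_gt0.
  rewrite lnM ?posrE ?exprn_gt0// lnXn// /D -[N.+1]addn1 natrD -[_ *+ N]mulr_natr.
  have := ler_norm (ln (4 / Cw)); have N0 : 0 <= N%:R :> R by [].
  have : 0 <= `|ln (4 / Cw)| * N%:R by rewrite mulr_ge0.
  lra.
exists (sine_series 1 k), (1 / (8 * pi * S * D)), T; split.
- exact: sine_series_besov.
- by rewrite divr_gt0 ?mulr_gt0 ?pi_gt0.
- apply: (@times_to_infty_powR _ _ k Cw^-1 1) => //; first by rewrite invr_gt0.
  move=> j; rewrite powRr1 ?enorm_ge0// mulrC.
  by have [/andP[]] := TP j.
move=> N; apply: le_trans (discrepancy_ge ltr01 k0 klac kw (T0 N) N.+1).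
have [_ hsum] := TP N.
apply: (@le_trans _ _ (1 / (4 * pi * S * T N) * (N.+1%:R / 2))).
  have c0 : 0 < 1 / (8 * pi * S * D * T N) by rewrite divr_gt0// !mulr_gt0 ?pi_gt0.
  apply: (@le_trans _ _ (1 / (8 * pi * S * D * T N) * (D * N.+1%:R))).
    rewrite (_ : _ * (ln _ / _) = 1 / (8 * pi * S * D * T N) * ln (T N)) ?ler_pM2l//.
    by move: (T0 N) (pi_gt0 R); move: (@pi R) => p ? ?; field; rewrite !gt_eqF.
  rewrite le_eqVlt; apply/orP; left; apply/eqP.
  move: (T0 N) (pi_gt0 R); move: (@pi R) (N.+1%:R : R) => p m ? ?.
  by field; rewrite !gt_eqF.
apply: (@le_trans _ _ (1 / (4 * pi * S * T N) *
   \sum_(0 <= i < N.+1) (1 - cos (2 * pi * dot (int_row R (k i)) w * T N)))).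
  by rewrite ler_pM2l// divr_gt0// !mulr_gt0 ?pi_gt0.
rewrite mulr_sumr /series /=; apply: ler_sum_nat => i _.
rewrite [leRHS]mulrCA [leLHS]mulrC ler_wpM2l ?subr_ge0 ?cos_le1//.
have ph0 := phase_gt0 kw (T0 N) i.
rewrite ler_pdivlMr// /sine_coef powR_inv1 ?enorm_ge0//.
rewrite -[leRHS]mul1r ler_pdivlMr//; apply: le_trans (_ : (2 * S)^-1 *
  (dot (int_row R (k i)) w * enorm (int_row R (k i))) <= _); last first.
  by rewrite mulrC ler_pdivrMr ?mulr_gt0// mul1r.
rewrite le_eqVlt; apply/orP; left; apply/eqP.
move: (T0 N) (pi_gt0 R); move: (@pi R) => p ? ?; field; by rewrite !gt_eqF.
Qed.

(** * Balanced frequencies and two-sided bounds *)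

(** Multiplying a frequency by [m] multiplies [theta |k|] by m^2.  Starting from a
Dirichlet frequency, for which this product is at most [c], the first [m] that
brings it to at least [c] overshoots by a factor at most 4, since
m^2 <= 4 (m - 1)^2 for m >= 2.  The new frequency is large because its square is
at least [c / theta], where [theta] belongs to the Dirichlet frequency. *)
Lemma balanced_frequency (R : realType) n (w : 'rV[R]_n) (i0 i1 : 'I_n) :
  i0 != i1 ->
  (forall a b : int, (a != 0) || (b != 0) ->
    a%:~R * w 0 i0 + b%:~R * w 0 i1 != 0) ->
  exists2 c : R, 0 < c & forall M : R, exists k : 'rV[int]_n,
    (0 < dot (int_row R k) w /\
     c <= dot (int_row R k) w * enorm (int_row R k) <= 4 * c) /\
    M <= enorm (int_row R k).
Proof.
move=> i01 indep; pose S : R := `|w 0 i0| + `|w 0 i1|.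
have S0 : 0 < S.
  rewrite ltr_wpDr// normr_gt0; have := indep 1 0 isT.
  by rewrite mul1r mul0r addr0.
exists (2 * S) => [|M]; first by rewrite mulr_gt0.
(* The frequency obtained below has square norm at least 2 Q. *)
pose Q := (Num.truncn (M ^+ 2)).+1.
have QM : M ^+ 2 < Q%:R by exact: truncnS_gt.
have Q0 : 0 < Q%:R :> R by rewrite ltr0n.
have [k [kQ kw' [a [b [ab k0 kab]]]]] := dirichlet_row w i01 (isT : (0 < Q)%N).
have kw0 : dot (int_row R k) w != 0 by rewrite kab; exact: indep.
have [l [lk lw0 lw]] := positive_sign kw0.
have l1 : 1 <= enorm (int_row R l) by rewrite lk enorm_ge1.
have {}kw' : dot (int_row R l) w <= S / Q%:R by rewrite lw.
rewrite -{}lk in kQ.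
set th := dot (int_row R l) w in lw0 kw' *; set nl := enorm (int_row R l) in l1 kQ *.
pose t := th * nl.
have t0 : 0 < t by rewrite mulr_gt0// (lt_le_trans ltr01).
have tS : t <= 2 * S.
  apply: (@le_trans _ _ (S / Q%:R * (2 * Q%:R))).
    by apply: ler_pM => //; [exact: ltW|rewrite (le_trans _ l1)].
  by rewrite mulrCA -mulrA mulVf ?gt_eqF// mulr1.
have exm : exists m : nat, 2 * S <= m%:R ^+ 2 * t.
  exists (Num.truncn (2 * S / t)).+1; rewrite -ler_pdivrMr//.
  have := truncnS_gt (2 * S / t); set m := (Num.truncn (2 * S / t)).+1 => hm.
  have m1 : 1 <= m%:R :> R by rewrite ler1n.
  by rewrite (le_trans (ltW hm))// expr2 ler_peMl// (le_trans _ m1).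
have [m mS mmin] := ex_minnP exm.
have m0 : (0 < m)%N.
  rewrite lt0n; apply: contraTneq mS => ->.
  by rewrite expr0n mul0r -ltNge mulr_gt0.
have m0R : 0 < m%:R :> R by rewrite ltr0n.
have mS4 : m%:R ^+ 2 * t <= 4 * (2 * S).
  case: m m0 m0R mS mmin => [//|[|m]] _ m0R mS mmin.
    by rewrite expr1n mul1r; lra.
  have mlt : m.+1%:R ^+ 2 * t < 2 * S.
    by rewrite ltNge; apply/negP => /mmin; rewrite ltnn.
  apply: (@le_trans _ _ ((2 * m.+1%:R) ^+ 2 * t)).
    rewrite ler_pM2r// lerXn2r ?nnegrE ?mulr_ge0//.
    by rewrite -natrM ler_nat mul2n -addnn addSn addnS !ltnS leq_addl.
  by rewrite exprMn -mulrA; lra.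
exists (l *+ m); rewrite int_rowMn dotZl enormZ// -/th -/nl.
have e : m%:R * th * (m%:R * nl) = m%:R ^+ 2 * t by rewrite /t; ring.
rewrite e mS mS4 mulr_gt0//; split=> //.
have big : 2 * Q%:R <= (m%:R * nl) ^+ 2.
  have h1 : 2 * S <= (m%:R * nl) ^+ 2 * th.
    rewrite (_ : _ * th = m%:R ^+ 2 * t * nl); last by rewrite /t; ring.
    by apply: (le_trans mS); rewrite ler_peMr// mulr_ge0//; exact: ltW.
  have h2 : (m%:R * nl) ^+ 2 * th <= (m%:R * nl) ^+ 2 * (S / Q%:R).
    by rewrite ler_wpM2l// sqr_ge0.
  have := le_trans h1 h2; rewrite mulrA ler_pdivlMr// => h3.
  by rewrite -(ler_pM2r S0); lra.
have nn : 0 <= m%:R * nl by rewrite mulr_ge0// (le_trans _ l1).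
rewrite leNgt; apply/negP => hM.
have : (m%:R * nl) ^+ 2 < M ^+ 2 by rewrite ltrXn2r ?nnegrE// (le_trans nn)// ltW.
lra.
Qed.

Lemma one_sub_cos_le (R : realType) (u : R) : 0 <= u -> 1 - cos u <= u.
Proof.
rewrite le_eqVlt => /predU1P[<-|u0]; first by rewrite cos0 subrr.
have cc : {within `[0, u], continuous (@cos R)}.
  by apply: continuous_subspaceT; exact: continuous_cos.
have [x _] := MVT u0 (fun t _ => is_derive_cos t) cc.
rewrite cos0 subr0 => h; have -> : 1 - cos u = sin x * u by lra.
by rewrite ler_piMl ?sin_le1// ltW.
Qed.

Lemma powR_invK (R : realType) (b : R) : 0 < b ->
  2 `^ b^-1 `^ b = 2.
Proof. by move=> b0; rewrite -powRrM mulVf ?gt_eqF// powRr1. Qed.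

(** Terms below [j] are dominated by a sequence that at least doubles, whose sum
before [j] is at most [g j]; the terms from [j] on are dominated by one that at
least halves.  Both geometric sums are handled by telescoping. *)
Lemma lacunary_series_le (R : realType) (t g a : nat -> R) (j : nat) :
  (forall i, 0 <= t i) -> (forall i, 0 <= g i) -> (forall i, 0 <= a i) ->
  (forall i, g i + g i <= g i.+1) -> (forall i, a i.+1 <= a i - a i.+1) ->
  (forall i, (i < j)%N -> t i <= g i) -> (forall i, t i <= a i) ->
  forall N, series t N <= g j + 2 * a j.
Proof.
move=> t0 g0 a0 gdouble ahalf tg ta N.
have lo M : (M <= j)%N -> series t M <= g M.
  elim: M => [_|M ih Mj]; first by rewrite /series /= big_geq.
  rewrite seriesSr; apply: le_trans (gdouble M).
  by rewrite lerD// ?ih ?(ltnW Mj)// tg.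
have hi M : series t (j + M)%N <= g j + 2 * a j - 2 * a (j + M)%N.
  elim: M => [|M ih]; first by have := lo j (leqnn j); rewrite addn0; lra.
  rewrite addnS seriesSr; have := ta (j + M)%N; have := ahalf (j + M)%N; lra.
have mono : {homo series t : m m' / (m <= m')%N >-> m <= m'}.
  by apply: nondecreasing_series => i _ _; exact: t0.
apply: le_trans (mono _ _ (leq_addl j N)) _; apply: le_trans (hi N) _.
by have := a0 (j + N)%N; lra.
Qed.

(** At the half period of the j-th wave, an earlier term is at most
4 |k_i|^(1 - alpha) / |k_j| and a later one at most |k_i|^(-alpha).  The lacunarity
factor [A] is chosen so that |k_i|^(1 - alpha) at least doubles and
|k_i|^(-alpha) at least halves from one index to the next. *)
Lemma two_sided_rate (R : realType) n (chi : R -> R) (w : 'rV[R]_n)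
    (i0 i1 : 'I_n) (alpha : R) : is_cutoff chi -> i0 != i1 ->
  (forall a b : int, (a != 0) || (b != 0) ->
    a%:~R * w 0 i0 + b%:~R * w 0 i1 != 0) ->
  0 < alpha < 1 ->
  exists (f : 'rV[R]_n -> R) (T : nat -> R) (C1 C2 : R),
    [/\ besov chi alpha f, times_to_infty T, 0 < C1, 0 < C2 &
      forall j : nat, 1 <= T j /\
        C1 * (1 / T j) `^ alpha <= discrepancy f w (T j)
          <= C2 * (1 / T j) `^ alpha].
Proof.
move=> chic i01 indep /andP[al0 al1].
have [c c0 exP] := balanced_frequency i01 indep.
pose A : R := 4 + (2 `^ alpha^-1 + 2 `^ (1 - alpha)^-1).
have al10 : 0 < 1 - alpha by lra.
have A4 : 4 <= A by rewrite lerDl addr_ge0 ?powR_ge0.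
have A0 : 0 < A by lra.
(* Starting at |k_0| >= 8 c ensures T_j >= |k_j| / (8 c) >= 1. *)
have [k [kP kA k0c]] := lacunary_choice A (8 * c) exP.
have kw i : 0 < dot (int_row R (k i)) w by have [] := kP i.
have k0 i : k i != 0 by apply: (@dot_neq0 _ _ w); rewrite gt_eqF.
have nk0 i : 0 < enorm (int_row R (k i)) by rewrite (lt_le_trans ltr01)// enorm_ge1.
have klac i : 4 * enorm (int_row R (k i)) <= enorm (int_row R (k i.+1)).
  by apply: le_trans (kA i); rewrite ler_pM2r.
pose a := @sine_coef R n alpha k.
have a0 i : 0 < a i by exact: sine_coef_gt0.
have ahalf i : a i.+1 <= a i - a i.+1.
  have hA : 2 <= A `^ alpha.
    rewrite -[leLHS](powR_invK al0) powR_homo ?powR_ge0 ?(ltW al0)//.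
    by rewrite /A; have := powR_ge0 2 (1 - alpha)^-1; lra.
  have h : a i.+1 * A `^ alpha <= a i.
    apply: (@le_trans _ _ ((A * enorm (int_row R (k i))) `^ (- alpha) * A `^ alpha)).
      rewrite ler_pM2r ?powR_gt0// powR_anti//; [exact: ltW|exact: mulr_gt0].
    rewrite powRM ?enorm_ge0 ?(ltW A0)// mulrAC powRN mulVf ?mul1r//.
    by rewrite gt_eqF// powR_gt0.
  rewrite lerBrDr -mulr2n -mulr_natr; apply: le_trans h.
  by apply: ler_wpM2l; [exact: ltW (a0 _)|exact: hA].
pose g i := enorm (int_row R (k i)) `^ (1 - alpha).
have gE i : g i = a i * enorm (int_row R (k i)).
  rewrite /g /a /sine_coef addrC powRD ?powRr1 ?enorm_ge0//.
  by rewrite (gt_eqF (nk0 i)) implybT.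
have gdouble i : g i + g i <= g i.+1.
  have hA : 2 <= A `^ (1 - alpha).
    rewrite -[leLHS](powR_invK al10) powR_homo ?powR_ge0 ?(ltW al10)//.
    by rewrite /A; have := powR_ge0 2 alpha^-1; lra.
  apply: (@le_trans _ _ ((A * enorm (int_row R (k i))) `^ (1 - alpha))).
    rewrite powRM ?enorm_ge0 ?(ltW A0)// -/(g i) -mulr2n -mulr_natl.
    by rewrite ler_wpM2r// powR_ge0.
  by rewrite powR_homo ?mulr_ge0 ?enorm_ge0 ?(ltW A0) ?(ltW al10).
pose x j := 2 * dot (int_row R (k j)) w.
have x0 j : 0 < x j by rewrite mulr_gt0.
have xlow j : 2 * c <= enorm (int_row R (k j)) * x j.
  by have [_ /andP[h _]] := kP j; rewrite /x; lra.
have xhigh j : enorm (int_row R (k j)) * x j <= 8 * c.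
  by have [_ /andP[_ h]] := kP j; rewrite /x; lra.
have kk0 j : enorm (int_row R (k 0)) <= enorm (int_row R (k j)).
  elim: j => // j ih; apply: le_trans ih _.
  by have := klac j; have := nk0 j; lra.
exists (sine_series alpha k), (fun j => 1 / x j),
  (2 / pi * ((8 * c) `^ alpha)^-1), (6 * ((2 * c) `^ alpha)^-1); split.
- exact: sine_series_besov.
- apply: (@times_to_infty_powR _ _ k (8 * c)^-1 1) => //.
    by rewrite invr_gt0 mulr_gt0.
  move=> j; rewrite powRr1 ?enorm_ge0// ler_pdivrMl ?mulr_gt0//.
  by rewrite mulrA mulr1 ler_pdivlMr.
- by rewrite mulr_gt0 ?divr_gt0 ?pi_gt0 ?invr_gt0 ?powR_gt0 ?mulr_gt0.
- by rewrite mulr_gt0 ?invr_gt0 ?powR_gt0 ?mulr_gt0.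
move=> j.
have T0 : 0 < 1 / x j by rewrite divr_gt0.
have -> : 1 / (1 / x j) = x j by rewrite !div1r invrK.
have nx0 : 0 <= enorm (int_row R (k j)) * x j by apply: mulr_ge0; exact: ltW.
have xa : x j `^ alpha = (enorm (int_row R (k j)) * x j) `^ alpha * a j.
  rewrite powRM ?enorm_ge0 ?(ltW (x0 j))// mulrAC /a /sine_coef powRN divff ?mul1r//.
  by rewrite gt_eqF// powR_gt0.
split.
  have h8 : 8 * c <= enorm (int_row R (k j)) by exact: le_trans k0c (kk0 j).
  rewrite ler_pdivlMr// mul1r -(ler_pM2l (nk0 j)) mulr1.
  exact: le_trans (xhigh j) h8.
apply/andP; split.
  apply: le_trans (discrepancy_half_period al0 k0 klac kw j).
  rewrite -[leLHS]mulrA ler_pM2l ?divr_gt0 ?pi_gt0// ler_pdivrMl ?powR_gt0 ?mulr_gt0//.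
  rewrite xa ler_pM2r; last exact: a0.
  by apply: powR_homo; [exact: ltW|exact: nx0|exact: xhigh].
apply: (@le_trans _ _ (6 * a j)); last first.
  rewrite -[leRHS]mulrA ler_pM2l// ler_pdivlMl ?powR_gt0 ?mulr_gt0//.
  rewrite xa ler_pM2r; last exact: a0.
  by apply: powR_homo; [exact: ltW|rewrite mulr_ge0// ltW|exact: xlow].
have term_lo i : (i < j)%N ->
    sine_coef alpha k i *
      ((1 - cos (2 * pi * dot (int_row R (k i)) w * (1 / x j))) /
       (2 * pi * dot (int_row R (k i)) w * (1 / x j))) <=
    4 * g i / enorm (int_row R (k j)).
  move=> ij; have := phase_gt0 kw T0 i.
  set ph := 2 * pi * _ * _ => ph0.
  have phx : ph * x j = pi * x i.
    by rewrite /ph div1r mulfVK ?gt_eqF// /x; ring.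
  have -> : 4 * g i / enorm (int_row R (k j)) =
    a i * (4 * enorm (int_row R (k i)) / enorm (int_row R (k j))) by rewrite gE; ring.
  rewrite ler_pM2l; last exact: a0.
  rewrite ler_pdivrMr// mulrAC ler_pdivlMr//.
  apply: (@le_trans _ _ (2 * enorm (int_row R (k j)))).
    rewrite ler_pM2r//; have := cos_geN1 ph; lra.
  rewrite -(ler_pM2r (x0 j)) -mulrA -[leRHS]mulrA phx.
  have h1 := xhigh j; have h2 := xlow i.
  have h3 : 2 * (2 * c) <= pi * (enorm (int_row R (k i)) * x i).
    by apply: ler_pM => //; rewrite ?mulr_ge0 ?(ltW c0)// pi_ge2.
  have -> : 4 * enorm (int_row R (k i)) * (pi * x i) =
    4 * (pi * (enorm (int_row R (k i)) * x i)) by ring.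
  lra.
have term_hi i :
    sine_coef alpha k i *
      ((1 - cos (2 * pi * dot (int_row R (k i)) w * (1 / x j))) /
       (2 * pi * dot (int_row R (k i)) w * (1 / x j))) <= a i.
  have ph := phase_gt0 kw T0 i.
  rewrite -[leRHS]mulr1 ler_pM2l; last exact: a0.
  rewrite ler_pdivrMr// [leRHS]mul1r; apply: one_sub_cos_le; exact: ltW.
apply: (discrepancy_le al0 k0 klac kw T0) => N.
have -> : 6 * a j = 4 * g j / enorm (int_row R (k j)) + 2 * a j.
  by rewrite gE mulrA mulfK ?gt_eqF//; ring.
apply: (lacunary_series_le (g := fun i => 4 * g i / enorm (int_row R (k j)))).
- by move=> i; exact: (line_term_ge0 _ kw T0).
- by move=> i; rewrite !mulr_ge0 ?invr_ge0 ?enorm_ge0 ?powR_ge0.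
- by move=> i; exact: ltW (a0 i).
- by move=> i; rewrite -mulrDl -mulrDr ler_pM2r ?invr_gt0// ler_pM2l.
- exact: ahalf.
- exact: term_lo.
- exact: term_hi.
Qed.

(** * Null sets of resonant vectors *)

Lemma measurable_hyperplane (R : realType) n (i0 i1 : 'I_n) (p q c : R) :
  measurable [set t : n.-tuple (measurableTypeR R) |
    p * tnth t i0 + q * tnth t i1 = c].
Proof.
have m : measurable_fun setT (fun t : n.-tuple (measurableTypeR R) =>
    p * tnth t i0 + q * tnth t i1).
  by apply: measurable_funD; apply: measurable_funM => //; exact: measurable_tnth.
by have := m measurableT [set c] (measurable_set1 c); rewrite setTI.
Qed.

Lemma null_first_coordinate (R : realType) n (c : R) :
  lebesgue_Rn R n.+1 [set t | tnth t ord0 = c] = 0%E.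
Proof.
rewrite /lebesgue_Rn /= /tuple_cons_measure /pushforward.
rewrite (_ : _ @^-1` _ = [set c] `*` setT); last first.
  by apply/seteqP; split=> [[x t]|[x t] []]; rewrite /= tnth0.
rewrite product_measure1E//.
by rewrite [X in (X * _)%E](lebesgue_measure_set1 c) mul0e.
Qed.

(** If the second coefficient vanishes the hyperplane fixes the first coordinate;
otherwise each section at a given first coordinate fixes the second one. *)
Lemma null_hyperplane (R : realType) n (p q : R) : (p != 0) || (q != 0) ->
  lebesgue_Rn R n.+2 [set t | p * tnth t ord0 + q * tnth t (lift ord0 ord0) = 0]
    = 0%E.
Proof.
have [->|q0 _] := eqVneq q 0.
  rewrite orbF => p0.
  rewrite -[RHS](null_first_coordinate n.+1 0); congr (lebesgue_Rn R n.+2 _).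
  apply/seteqP; split=> t /=; rewrite mul0r addr0; last by move=> ->; rewrite mulr0.
  by move/eqP; rewrite mulf_eq0 (negbTE p0) => /eqP.
rewrite /lebesgue_Rn /= /tuple_cons_measure /pushforward.
rewrite /product_measure1; apply: integral0_eq => x _ /=.
rewrite -[RHS](null_first_coordinate n (- p * x / q)) /lebesgue_Rn /=.
congr (tuple_cons_measure _ _ _).
apply/seteqP; split=> t; rewrite /xsection /= inE /= /pair_cons tnth0 tnthS => h.
  apply: (mulfI q0); rewrite mulrCA divff// mulr1 mulNr.
  by apply/eqP; rewrite -addr_eq0 addrC h.
by rewrite h mulrCA divff// mulr1 mulNr subrr.
Qed.

(** The resonant vectors form a countable union of null hyperplanes; the pairs of
coefficients are enumerated by [unpickle]. *)
Lemma ae_independent (R : realType) n :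
  {ae lebesgue_Rn R n.+2, forall t : n.+2.-tuple (measurableTypeR R),
    forall a b : int, (a != 0) || (b != 0) ->
      a%:~R * tnth t ord0 + b%:~R * tnth t (lift ord0 ord0) != 0 :> R}.
Proof.
pose P (m : nat) (t : n.+2.-tuple (measurableTypeR R)) :=
  forall a b : int, unpickle m = Some (a, b) -> (a != 0) || (b != 0) ->
    a%:~R * tnth t ord0 + b%:~R * tnth t (lift ord0 ord0) != 0 :> R.
have : {ae lebesgue_Rn R n.+2, forall t, forall m, P m t}.
  apply: ae_foralln => m; rewrite /P.
  case: (unpickle m) => [[a b]|]; last exact: aeW.
  have [ab|ab] := boolP ((a != 0) || (b != 0)); last first.
    by apply: aeW => t a' b' [<- <-]; rewrite (negbTE ab).
  exists [set t | a%:~R * tnth t ord0 + b%:~R * tnth t (lift ord0 ord0) = 0 :> R].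
  split.
  - exact: measurable_hyperplane.
  - by apply: null_hyperplane; rewrite !intr_eq0.
  - move=> t /= nt; apply: contrapT => /eqP h; apply: nt => a' b' [<- <-] _.
    exact: h.
by apply: filterS => t h a b; apply: (h (pickle (a, b))); rewrite pickleK.
Qed.

Unset Implicit Arguments.

Theorem theorem1p2 (R : realType) (n : nat) (n_ge2 : (2 <= n)%N)
    (chi : R -> R) (chi_cutoff : is_cutoff chi) :
  [/\ (* (i) *)
      {ae lebesgue_Rn R n, forall w0 : n.-tuple (measurableTypeR R),
        let w := row_of_tuple w0 in
        forall s : R, 0 < s ->
        exists (f : 'rV[R]_n -> R) (C : R) (T : nat -> R),
          [/\ besov chi s f, 0 < C, times_to_infty T &
              forall j : nat, C * (1 / T j) <= discrepancy f w (T j)]},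
      (* (ii) *)
      n = 2%N ->
      forall (Cw : R) (w : 'rV[R]_n), 0 < Cw -> diophantine 1 Cw w ->
        exists (f : 'rV[R]_n -> R) (C : R) (T : nat -> R),
          [/\ besov chi 1 f, 0 < C, times_to_infty T &
              forall j : nat, C * (ln (T j) / T j) <= discrepancy f w (T j)],
      (* (iii) *)
      forall (sigma Cw : R) (w : 'rV[R]_n), 0 < sigma -> 0 < Cw ->
        diophantine sigma Cw w -> exact_index sigma Cw w ->
        forall s : R, 0 < s < sigma ->
        exists (f : 'rV[R]_n -> R) (C : R) (T : nat -> R),
          [/\ besov chi s f, 0 < C, times_to_infty T &
              forall j : nat,
                C * (1 / T j) `^ (s / sigma) <= discrepancy f w (T j)] &
      (* (iv) *)
      forall alpha : R, 0 < alpha < 1 ->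
        {ae lebesgue_Rn R n, forall w0 : n.-tuple (measurableTypeR R),
          let w := row_of_tuple w0 in
          exists (f : 'rV[R]_n -> R) (T : nat -> R) (C1 : R) (C2 : R -> R),
            [/\ besov chi alpha f, times_to_infty T, 0 < C1,
                forall eps : R, 0 < eps -> 0 < C2 eps &
                forall (eps : R) (j : nat), 0 < eps ->
                  C1 * (1 / T j) `^ alpha <= discrepancy f w (T j)
                    <= C2 eps * (1 / T j) `^ (alpha / (n%:R - 1 + eps))]}].
Proof.
case: n n_ge2 => [//|[//|n]] _; split.
- have := @ae_independent R n; apply: filterS => t indep s s0.
  set w := row_of_tuple t.
  have wt i : w 0 i = tnth t i by rewrite /w row_of_tupleE.
  apply: (@single_frequency_rate _ _ _ _ (delta_mx 0 ord0)) => //.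
  have := indep 1 0 isT; rewrite mul1r mul0r addr0 -wt.
  apply: contra_neq => <-; rewrite /dot (bigD1 ord0)//= !mxE !eqxx mul1r.
  by rewrite big1 ?addr0// => i i0; rewrite !mxE (negbTE i0) andbF mul0r.
- by move=> _ Cw w; exact: (@badly_approximable_rate _ _ _ _ _ ord0 (lift ord0 ord0)).
- move=> sigma Cw w sigma0 Cw0 _ wex s /andP[s0 _].
  exact: exact_index_rate wex s0.
move=> alpha al; have /andP[al0 al1] := al.
have := @ae_independent R n; apply: filterS => t indep.
set w := row_of_tuple t.
have wt i : w 0 i = tnth t i by rewrite /w row_of_tupleE.
have [|f [T [C1 [C2 [fB Too C10 C20 h]]]]] :=
  @two_sided_rate _ _ _ w ord0 (lift ord0 ord0) _ chi_cutoff isT _ al.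
  by move=> a b ab; rewrite !wt; exact: indep.
exists f, T, C1, (fun=> C2); split=> // eps j eps0.
have [T1 /andP[-> hi]] := h j; apply: le_trans hi _.
rewrite ler_pM2l//; apply: ger_powR.
  by rewrite div1r invr_gt0 invf_le1 ?(lt_le_trans ltr01 T1)//.
have n1 : 1 <= n.+2%:R - 1 + eps.
  by rewrite -[n.+2]addn2 natrD; have := ler0n R n; lra.
by rewrite ler_pdivrMr ?(lt_le_trans ltr01 n1)// ler_peMr// ltW.
Qed.
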